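(* Let $e_1,e_2,e_3$ be pairwise distinct complex numbers with $e_1+e_2+e_3=0$ and let $f(u)=(u-e_1)(u-e_2)(u-e_3)$. Consider the affine surface $$\mathcal M=\Big\{(\rho,u,w)\in\mathbb{C}^3:\ \rho^2=-(2u+w)f(u)+\tfrac14 f'(u)^2\Big\},$$ and, for $w\in\mathbb{C}$, the curve $\mathbf F_w\subset\mathbb{C}^2$ obtained from the equation of $\mathcal M$ by fixing $w$. Then: (i) $\mathbf F_w$ is singular if and only if $w\in\{e_1,e_2,e_3\}$; for all other $w$ it is (after adding its points at infinity) a smooth curve of genus 1. (ii) For $\{i,j,k\}=\{1,2,3\}$, the curve $\mathbf F_{e_i}$ is the union of the two genus zero curves $$\rho=\pm\tfrac12\big((u-e_i)^2-(e_i-e_j)(e_i-e_k)\big),$$ which meet in exactly the two points given by $\rho=0$, $u=e_i\pm\sqrt{(e_i-e_j)(e_i-e_k)}$. (iii) The surface $\mathcal M$ is smooth, including at the singular points of the fibers $\mathbf F_{e_i}$.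
   Context: The surface $\mathcal M$ is an affine model (with some points at $u,\rho=\infty$ omitted) of the moduli space of stable $SL_2$ Higgs bundles with one simple-pole ramification point on the genus 1 curve $y^2=f(x)$, and the map $(\rho,u,w)\mapsto w$ is its Hitchin fibration; only the explicit equation is needed for the claim. The right hand side of the equation is a quartic polynomial in $u$ with non-zero leading coefficient, and ''adding the points at infinity'' means passing to the double cover of $\mathbb{P}^1$ (with coordinate $u$) branched at the roots of this quartic. *)

(* Defs.v *)
From HB Require Import structures.
From mathcomp Require Import all_boot all_order all_algebra.
From mathcomp Require Import reals complex mpoly.

Set Implicit Arguments.
Unset Strict Implicit.
Unset Printing Implicit Defensive.

Import Order.TTheory GRing.Theory Num.Theory.

Local Open Scope ring_scope.

Section Hypersurface.
Variables (C : fieldType) (n : nat).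
Implicit Types (p : {mpoly C[n]}) (v : 'I_n -> C).

Definition zero_set p v : Prop := p.@[v] = 0.

Definition singular_point p v : Prop :=
  zero_set p v /\ forall i : 'I_n, (p^`M(i)).@[v] = 0.

Definition singular p : Prop := exists v, singular_point p v.

Definition smooth_point p v : Prop :=
  zero_set p v /\ exists i : 'I_n, (p^`M(i)).@[v] != 0.

Definition smooth p : Prop := forall v, zero_set p v -> smooth_point p v.

End Hypersurface.

(* [K], with [iota : C -> K] and the coordinate functions [x], is the function
   field of the irreducible affine variety [X] in C^n: the polynomial relations
   between the [x i] are the polynomials vanishing on [X] (in particular the
   vanishing ideal of [X] is prime), and the [x i] generate [K] over C. *)
Definition is_function_field (C : fieldType) (n : nat)
    (X : ('I_n -> C) -> Prop)
    (K : fieldType) (iota : {rmorphism C -> K}) (x : 'I_n -> K) : Prop :=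
  (forall p : {mpoly C[n]},
     mmap iota x p = 0 <-> forall v, X v -> p.@[v] = 0)
  /\ (forall z : K, exists p q : {mpoly C[n]}, z = mmap iota x p / mmap iota x q).

Section FunctionField.
Variables (C K : fieldType) (iota : {rmorphism C -> K}).

Definition is_derivation (D : K -> K) : Prop :=
  [/\ forall c, D (iota c) = 0,
      forall a b, D (a + b) = D a + D b
    & forall a b, D (a * b) = D a * b + a * D b].

(* [D] spans the K-vector space Der_C(K), which has dimension 1. In
   characteristic 0 this dimension is the transcendence degree of K over C, so
   such a [D] exists only for function fields of curves. *)
Definition derivation_basis (D : K -> K) : Prop :=
  [/\ is_derivation D, exists a, D a <> 0
    & forall D', is_derivation D' -> exists h, forall a, D' a = h * D a].

(* Valuation rings of K over C: the points of the smooth complete curve with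
   function field K, each given by its local ring. *)
Definition is_place (V : K -> Prop) : Prop :=
  [/\ forall c, V (iota c),
      forall a b, V a -> V b -> V (a - b),
      forall a b, V a -> V b -> V (a * b),
      forall a, V a \/ V a^-1
    & exists a, ~ V a].

Variable D : K -> K.

(* Evaluation at a basis [D] of Der_C(K) identifies the space of rational
   differentials of K/C with K, the differential [a db] becoming [a * D b].
   Regularity at [V] means lying in the V-span of the [db] with b in V. *)
Definition regular_at (V : K -> Prop) (g : K) : Prop :=
  exists s : seq (K * K),
    (forall ab, ab \in s -> V ab.1 /\ V ab.2)
    /\ g = \sum_(ab <- s) ab.1 * D ab.2.

Definition regular_differential (g : K) : Prop :=
  forall V, is_place V -> regular_at V g.

(* Unique expression of 0 gives the linear independence of [b]. *)
Definition regular_differentials_basis (d : nat) (b : 'I_d -> K) : Prop :=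
  (forall i, regular_differential (b i))
  /\ (forall g, regular_differential g ->
        exists! c : {ffun 'I_d -> C}, g = \sum_i iota (c i) * b i).

End FunctionField.

(* [X] is an irreducible affine curve, and the space of regular differentials
   on its smooth complete model has dimension [g] over C. *)
Definition has_genus (C : fieldType) (n : nat)
    (X : ('I_n -> C) -> Prop) (g : nat) : Prop :=
  exists (K : fieldType) (iota : {rmorphism C -> K}) (x : 'I_n -> K)
         (D : K -> K) (b : 'I_g -> K),
    [/\ is_function_field X iota x, derivation_basis iota D
      & regular_differentials_basis iota D b].

Section DoubleCover.
Variable C : fieldType.

(* y^2 = q(u), with the coordinates of C^2 in the order (y, u). *)
Definition double_cover (q : {poly C}) : {mpoly C[2]} :=
  'X_0 ^+ 2 - horner_alg 'X_1 q.

(* For [q] of degree 4, the double cover of P^1 branched at the roots of [q] is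
   covered by [double_cover q] and by the chart [double_cover (reciprocal4 q)],
   glued along (y', u') = (y / u^2, 1 / u), where [reciprocal4 q] is
   u'^4 q(1 / u'). The points at infinity are those with u' = 0. *)
Definition reciprocal4 (q : {poly C}) : {poly C} := \poly_(i < 5) q`_(4 - i).

Definition smooth_completed_double_cover (q : {poly C}) : Prop :=
  [/\ size q = 5, smooth (double_cover q)
    & smooth (double_cover (reciprocal4 q))].

End DoubleCover.

Section Surface.
Variables (C : fieldType) (e : 'I_3 -> C).

Definition cubic : {poly C} := \prod_(i < 3) ('X - (e i)%:P).

(* The right-hand side of the equation, with [u] and [w] in any C-algebra. *)
Definition rhs (A : comAlgType C) (u w : A) : A :=
  - (u *+ 2 + w) * horner_alg u cubic
  + 4%:R^-1 *: horner_alg u cubic^`() ^+ 2.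

(* rho^2 = rhs u w, with the coordinates of C^3 in the order (rho, u, w). *)
Definition surface : {mpoly C[3]} := 'X_0 ^+ 2 - rhs 'X_1 'X_2.

Definition fiber_quartic (w : C) : {poly C} := rhs 'X w%:P.

Definition fiber (w : C) : {mpoly C[2]} := double_cover (fiber_quartic w).

(* rho = s / 2 * ((u - e_i)^2 - (e_i - e_j) (e_i - e_k)), for a sign [s]. *)
Definition fiber_component (s : C) (i j k : 'I_3) : {mpoly C[2]} :=
  'X_0 - (s / 2%:R) *: (('X_1 - (e i)%:MP) ^+ 2
                        - ((e i - e j) * (e i - e k))%:MP).

End Surface.

Definition point3 (C : Type) (v : 'I_2 -> C) (w : C) : 'I_3 -> C :=
  fun l => tnth [tuple v ord0; v ord_max; w] l.

Lemma meval_horner_alg (C : fieldType) n (v : 'I_n -> C) (u : {mpoly C[n]})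
    (p : {poly C}) : (horner_alg u p).@[v] = p.[u.@[v]].
Proof.
elim/poly_ind: p => [|p c IH]; first by rewrite !rmorph0 horner0.
rewrite rmorphD rmorphM /= horner_algX horner_algC mevalD mevalM IH.
by rewrite hornerMXaddC mevalZ meval1 mulr1.
Qed.

Lemma horner_alg_polyX (C : fieldType) (p : {poly C}) : horner_alg 'X p = p.
Proof.
elim/poly_ind: p => [|p c IH]; first by rewrite rmorph0.
by rewrite rmorphD rmorphM /= horner_algX horner_algC IH alg_polyC.
Qed.

(* [fiber e w] is the slice of [surface e] at the given [w]. *)
Lemma meval_fiber (C : fieldType) (e : 'I_3 -> C) (w : C) (v : 'I_2 -> C) :
  (fiber e w).@[v] = (surface e).@[point3 v w].
Proof.
have h0 : ('X_0 : {mpoly C[2]}).@[v] = v ord0.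
  by rewrite mevalXU; congr v; apply/val_inj.
have h1 : ('X_1 : {mpoly C[2]}).@[v] = v ord_max.
  by rewrite mevalXU; congr v; apply/val_inj.
have k0 : ('X_0 : {mpoly C[3]}).@[point3 v w] = v ord0.
  by rewrite mevalXU /point3 (tnth_nth 0).
have k1 : ('X_1 : {mpoly C[3]}).@[point3 v w] = v ord_max.
  by rewrite mevalXU /point3 (tnth_nth 0).
have k2 : ('X_2 : {mpoly C[3]}).@[point3 v w] = w.
  by rewrite mevalXU /point3 (tnth_nth 0).
rewrite /fiber /double_cover /surface /fiber_quartic /rhs !horner_alg_polyX.
rewrite !mevalB !rmorphXn /= h0 k0 meval_horner_alg h1.
rewrite mevalD mevalM mevalN mevalD mevalMn k1 k2 mevalZ rmorphXn /=.
by rewrite !meval_horner_alg k1 !hornerE mulr2n.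
Qed.

(* Main.v *)
(* For [w] distinct from the [e i], y^2 = q(u) has the function field K = F(y),
    F = C(u), and K/C has the derivation D = y d/du, for which du/y is [1].  A
    Bezout relation between q and q' shows that du/y is regular at every place
    where u is finite; the chart (1/u, -y/u^2) has the same shape and covers the
    other places.  Conversely a regular differential g du/y has g in the local
    ring of every point of both charts, since these local rings are valuation
    rings stable under D.  Then the trace and the norm of g to C(u) have no pole
    on the projective line, so they are constant and g is constant.

    For the components of the singular fibers, K = C(u) and D = d/du; at
    infinity D takes the local ring to (1/u)^2 times itself, so that a regular
    differential is a constant vanishing at infinity. *)

From HB Require Import structures.
Require Import Defs.
From mathcomp Require Import all_boot all_order all_algebra.
From mathcomp Require Import reals complex mpoly.
From mathcomp Require Import ring.

Set Implicit Arguments.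
Unset Strict Implicit.
Unset Printing Implicit Defensive.

Import Order.TTheory GRing.Theory Num.Theory.

Local Open Scope ring_scope.

(** No completion or abstract localization is built. A chart is the ring [quad q] of pairs over
    C[u]; its embedding in K and its evaluations at points with values in C are both instances of
    [quad_lift]. A local ring is then a predicate on K. It is a valuation ring once there are a
    uniformizer and a bound on orders of vanishing, and the norm down to C[u] supplies the bound.

    Besides generating K, a chart must satisfy y^2 = q(u) with q separable, D u = y and 2 D y =
    q'(u). These relations reappear unchanged at infinity, so each argument about a chart is made
    once and used twice.

    For the equation itself, e_1 + e_2 + e_3 = 0 gives f'' = 6u, and the u-derivative of the quartic
    q_w collapses to (u - w) f' - 2 f. Eliminating f from q_w = q_w' = 0 and comparing with the
    Taylor expansion of f then forces f(w) = 0. On the surface the w-derivative is f(u), so a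
    singular point would give a double root of f. *)

(** * Quadratic extensions *)

(* [(a, b) : quad q] stands for a + b * sqrt q. *)
Definition quad (R : comNzRingType) (q : R) : Type := (R * R)%type.

Section Quad.
Variables (R : comNzRingType) (q : R).

HB.instance Definition _ := GRing.Zmodule.copy (quad q) (R * R)%type.

Definition quad_one : quad q := (1, 0).
Definition quad_mul (x y : quad q) : quad q :=
  (x.1 * y.1 + q * (x.2 * y.2), x.1 * y.2 + x.2 * y.1).

Fact quad_mulA : associative quad_mul.
Proof. by move=> x y z; congr (_, _) => /=; ring. Qed.

Fact quad_mulC : commutative quad_mul.
Proof. by move=> x y; congr (_, _) => /=; ring. Qed.

Fact quad_mul1 : left_id quad_one quad_mul.
Proof. by case=> a b; congr (_, _) => /=; ring. Qed.

Fact quad_mulDl : left_distributive quad_mul +%R.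
Proof. by move=> x y z; congr (_, _) => /=; ring. Qed.

Fact quad_one_neq0 : quad_one != 0.
Proof. by apply/eqP => -[/eqP]; rewrite oner_eq0. Qed.

HB.instance Definition _ := GRing.Zmodule_isComNzRing.Build (quad q)
  quad_mulA quad_mulC quad_mul1 quad_mulDl quad_one_neq0.

Lemma quad_mulE (x y : quad q) :
  x * y = (x.1 * y.1 + q * (x.2 * y.2), x.1 * y.2 + x.2 * y.1) :> quad q.
Proof. by []. Qed.

Lemma quad_addE (x y : quad q) : x + y = (x.1 + y.1, x.2 + y.2) :> quad q.
Proof. by []. Qed.

Lemma quad_eq0 (x : quad q) : (x == 0) = (x.1 == 0) && (x.2 == 0).
Proof. by []. Qed.

Definition quadC (a : R) : quad q := (a, 0).

Fact quadC_is_zmod_morphism : zmod_morphism quadC.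
Proof. by move=> a b; congr (_, _); rewrite /= subrr. Qed.

Fact quadC_is_monoid_morphism : monoid_morphism quadC.
Proof. by split=> // a b; congr (_, _) => /=; ring. Qed.

HB.instance Definition _ :=
  GRing.isZmodMorphism.Build R (quad q) quadC quadC_is_zmod_morphism.
HB.instance Definition _ :=
  GRing.isMonoidMorphism.Build R (quad q) quadC quadC_is_monoid_morphism.

Definition quad_root : quad q := (0, 1).

Lemma quad_root_sqr : quad_root ^+ 2 = quadC q.
Proof. by rewrite expr2 quad_mulE /=; congr (_, _); ring. Qed.

Definition quad_conj (x : quad q) : quad q := (x.1, - x.2).
Definition quad_norm (x : quad q) : R := x.1 ^+ 2 - q * x.2 ^+ 2.

Lemma quad_conjM x y : quad_conj (x * y) = quad_conj x * quad_conj y.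
Proof. by rewrite !quad_mulE; congr (_, _) => /=; ring. Qed.

Lemma quad_mul_conj x : x * quad_conj x = quadC (quad_norm x).
Proof. by rewrite quad_mulE /quad_norm; congr (_, _) => /=; ring. Qed.

End Quad.

Section QuadLift.
Variables (R S : comNzRingType) (q : R) (f : {rmorphism R -> S}).

(** The equation is an argument so that the morphism structure can be attached to [quad_lift]
    itself. For R = C[u], taking S = K embeds the coordinate ring, and S = C evaluates it at a point
    of the curve. *)
Definition quad_lift (y : S) (_ : y ^+ 2 = f q) (x : quad q) : S :=
  f x.1 + f x.2 * y.

Variables (y : S) (y2 : y ^+ 2 = f q).
Local Notation lift := (quad_lift y2).

Fact quad_lift_is_zmod_morphism : zmod_morphism lift.
Proof. by move=> a b; rewrite /quad_lift /= !rmorphB; ring. Qed.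

Fact quad_lift_is_monoid_morphism : monoid_morphism lift.
Proof.
split=> [|a b]; first by rewrite /quad_lift rmorph1 rmorph0 mul0r addr0.
rewrite quad_mulE /quad_lift /= !rmorphD !rmorphM -y2; ring.
Qed.

HB.instance Definition _ :=
  GRing.isZmodMorphism.Build (quad q) S lift quad_lift_is_zmod_morphism.
HB.instance Definition _ :=
  GRing.isMonoidMorphism.Build (quad q) S lift quad_lift_is_monoid_morphism.

Lemma quad_liftC a : lift (quadC q a) = f a.
Proof. by rewrite /quad_lift /= rmorph0 mul0r addr0. Qed.

Lemma quad_lift_root : lift (quad_root q) = y.
Proof. by rewrite /quad_lift /= rmorph0 rmorph1 mul1r add0r. Qed.

End QuadLift.

(** The type carries the proof [nsq], so that the field structure can be inferred from it. *)
Definition quad_field (F : fieldType) (q : F) (nsq : forall a, a ^+ 2 != q) :=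
  quad q.

Section QuadField.
Variables (F : fieldType) (q : F) (nsq : forall a, a ^+ 2 != q).

HB.instance Definition _ := GRing.ComNzRing.copy (quad_field nsq) (quad q).

Definition quad_inv (x : quad_field nsq) : quad_field nsq :=
  (x.1 / quad_norm (x : quad q), - x.2 / quad_norm (x : quad q)).

Lemma quad_norm_eq0 (x : quad q) : (quad_norm x == 0) = (x == 0).
Proof.
rewrite quad_eq0 /quad_norm; case: x => a b /=.
have [->|b0] := eqVneq b 0; first by rewrite expr0n mulr0 subr0 sqrf_eq0 andbT.
rewrite andbF subr_eq0; apply/negP => /eqP h.
by have/eqP := nsq (a / b); apply; rewrite expr_div_n h mulfK ?sqrf_eq0.
Qed.

Fact quad_mulVf (x : quad_field nsq) : x != 0 -> quad_inv x * x = 1.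
Proof.
rewrite -quad_norm_eq0 /quad_inv (quad_mulE (q := q)) /=.
case: x => a b; rewrite /quad_norm /= => n0.
by congr (_, _); field.
Qed.

Fact quad_inv0 : quad_inv 0 = 0.
Proof. by rewrite /quad_inv /= oppr0 !mul0r. Qed.

HB.instance Definition _ :=
  GRing.ComNzRing_isField.Build (quad_field nsq) quad_mulVf quad_inv0.

Definition quad_fieldC (a : F) : quad_field nsq := quadC q a.

HB.instance Definition _ := GRing.isZmodMorphism.Build F (quad_field nsq)
  quad_fieldC (quadC_is_zmod_morphism q).
HB.instance Definition _ := GRing.isMonoidMorphism.Build F (quad_field nsq)
  quad_fieldC (quadC_is_monoid_morphism q).

Definition quad_field_conj (x : quad_field nsq) : quad_field nsq := quad_conj (x : quad q).

Fact quad_field_conj_is_zmod_morphism : zmod_morphism quad_field_conj.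
Proof. by move=> x y; congr (_, _) => /=; ring. Qed.

Fact quad_field_conj_is_monoid_morphism : monoid_morphism quad_field_conj.
Proof. by split=> [|x y]; [congr (_, _); rewrite oppr0 | apply: quad_conjM]. Qed.

HB.instance Definition _ := GRing.isZmodMorphism.Build (quad_field nsq)
  (quad_field nsq) quad_field_conj quad_field_conj_is_zmod_morphism.
HB.instance Definition _ := GRing.isMonoidMorphism.Build (quad_field nsq)
  (quad_field nsq) quad_field_conj quad_field_conj_is_monoid_morphism.

End QuadField.

(** * Derivations and local rings *)

Section Derivations.
Variables (C K : fieldType) (iota : {rmorphism C -> K}).

Lemma derivation0 (D : K -> K) : is_derivation iota D -> D 0 = 0.
Proof. by case=> /(_ 0); rewrite rmorph0. Qed.

Lemma derivation1 (D : K -> K) : is_derivation iota D -> D 1 = 0.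
Proof. by case=> /(_ 1); rewrite rmorph1. Qed.

Lemma derivation_div (D : K -> K) a b : is_derivation iota D -> b != 0 ->
  D (a / b) = (D a * b - a * D b) / b ^+ 2.
Proof.
move=> Dd b0; have [_ _ DM] := Dd.
have := DM (a / b) b; rewrite divfK // => ->.
by field.
Qed.

End Derivations.

Section LocalRing.
Variables (C K : fieldType) (A : comNzRingType).
Variables (iota : {rmorphism C -> K}).
Variables (eps : {rmorphism A -> K}) (phi : {rmorphism A -> C}).

(** With [eps] the inclusion of a coordinate ring and [phi] the evaluation at a point, this is the
    localization at the kernel of [phi], seen inside K. *)
Definition local_ring (z : K) : Prop :=
  exists n d, phi d != 0 /\ z = eps n / eps d.

Hypothesis eps_inj : injective eps.

Lemma local_denom_neq0 d : phi d != 0 -> eps d != 0.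
Proof.
apply: contraNneq => d0; suff -> : d = 0 by rewrite rmorph0.
by apply: eps_inj; rewrite d0 rmorph0.
Qed.

Lemma local_ring_eps n : local_ring (eps n).
Proof. by exists n, 1; rewrite !rmorph1 divr1 oner_neq0. Qed.

Lemma local_ringB a b : local_ring a -> local_ring b -> local_ring (a - b).
Proof.
move=> [n [d [d0 ->]]] [n' [d' [d'0 ->]]].
exists (n * d' - n' * d), (d * d'); rewrite !rmorphM mulf_neq0 //; split=> //.
have := local_denom_neq0 d0; have := local_denom_neq0 d'0 => e0 e1.
by rewrite rmorphB !rmorphM; field; rewrite e0 e1.
Qed.

Lemma local_ringM a b : local_ring a -> local_ring b -> local_ring (a * b).
Proof.
move=> [n [d [d0 ->]]] [n' [d' [d'0 ->]]].
exists (n * n'), (d * d'); rewrite !rmorphM mulf_neq0 //; split=> //.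
have := local_denom_neq0 d0; have := local_denom_neq0 d'0 => e0 e1.
by field; rewrite e0 e1.
Qed.

Lemma local_ringD a b : local_ring a -> local_ring b -> local_ring (a + b).
Proof.
move=> ha hb; rewrite -[b]opprK; apply: local_ringB => //.
rewrite -[- b]add0r; apply: local_ringB => //.
by rewrite -(rmorph0 eps); apply: local_ring_eps.
Qed.

Section Place.
Variable t : A.
Hypotheses (t_neq0 : t != 0) (phi_t : phi t = 0).
Hypothesis t_div : forall n, phi n = 0 ->
  exists s n', phi s != 0 /\ s * n = t * n'.
Hypothesis t_fin : forall n, n != 0 ->
  exists c m w, phi w != 0 /\ n * c = t ^+ m * w.

Let eps_t : eps t != 0.
Proof. by apply: contraNneq t_neq0 => h; apply/eqP/eps_inj; rewrite h rmorph0. Qed.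

(** While n vanishes at the point, [t_div] extracts one more factor t. By [t_fin] some multiple of n
    has order exactly m, so this stops after at most m extractions; the induction is on m. *)
Lemma local_ring_factor n : n != 0 ->
  exists k s v, [/\ phi s != 0, phi v != 0 & s * n = t ^+ k * v].
Proof.
move=> /t_fin [c [m [w [w0 e]]]].
elim: m n c w w0 e => [|m IH] n c w w0 e.
  exists 0%N, 1, n; rewrite rmorph1 oner_neq0 expr0 !mul1r; split=> //.
  apply: contraNneq w0 => n0.
  by rewrite expr0 mul1r in e; rewrite -e rmorphM n0 mul0r.
have [n0|n0] := eqVneq (phi n) 0; last first.
  by exists 0%N, 1, n; rewrite rmorph1 oner_neq0 expr0 !mul1r.
have [s [n' [s0 e']]] := t_div n0.
(* A is not assumed to be a domain, so t is cancelled in K. *)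
have e2 : n' * c = t ^+ m * (s * w).
  apply: eps_inj; apply: (mulfI eps_t).
  by rewrite -!rmorphM mulrA -e' -mulrA e exprS; congr (eps _); ring.
have [|k [s' [v [s'0 v0 e3]]]] := IH _ _ _ _ e2.
  by rewrite rmorphM mulf_neq0.
exists k.+1, (s' * s), v; rewrite rmorphM mulf_neq0 //; split=> //.
by rewrite -mulrA e' mulrCA e3 exprS; ring.
Qed.

Hypothesis eps_iota : forall c, exists a, eps a = iota c.
Hypothesis eps_gen : forall z, exists n d, d != 0 /\ z = eps n / eps d.

(** A nonzero element of K is a power of t, possibly negative, times a unit. The sign of the
    exponent decides between z and its inverse, and the inverse of t lies outside. *)
Lemma local_ring_is_place : is_place iota local_ring.
Proof.
split.
- by move=> c; have [a <-] := eps_iota c; apply: local_ring_eps.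
- exact: local_ringB.
- exact: local_ringM.
- move=> z; have [n [d [d0 ->]]] := eps_gen z.
  have [->|n0] := eqVneq n 0.
    by left; rewrite rmorph0 mul0r -(rmorph0 eps); apply: local_ring_eps.
  have [k [s [v [s0 v0 e]]]] := local_ring_factor n0.
  have [l [s' [v' [s'0 v'0 e']]]] := local_ring_factor d0.
  have S := local_denom_neq0 s0; have S' := local_denom_neq0 s'0.
  have W := local_denom_neq0 v0; have W' := local_denom_neq0 v'0.
  have En : eps n = eps t ^+ k * eps v / eps s.
    by rewrite -rmorphXn -rmorphM -e rmorphM mulrC mulKf.
  have Ed : eps d = eps t ^+ l * eps v' / eps s'.
    by rewrite -rmorphXn -rmorphM -e' rmorphM mulrC mulKf.
  rewrite En Ed; case: (leqP l k) => lk; [left|right].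
    exists (t ^+ (k - l) * v * s'), (s * v'); rewrite rmorphM mulf_neq0 //.
    split=> //; rewrite !rmorphM rmorphXn -{1}(subnK lk) exprD.
    by have T := expf_neq0 l eps_t; field; rewrite ?S ?S' ?W' ?eps_t ?T.
  exists (t ^+ (l - k) * v' * s), (s' * v); rewrite rmorphM mulf_neq0 //.
  split=> //; rewrite !rmorphM rmorphXn -{1}(subnK (ltnW lk)) exprD.
  by field; rewrite S S' W W' !expf_neq0.
- exists (eps t)^-1 => -[n [d [d0 e]]].
  have D0 := local_denom_neq0 d0.
  have e2 : d = t * n.
    by apply: eps_inj; rewrite rmorphM; apply: (canRL (mulVKf eps_t)); rewrite e divfK.
  by move: d0; rewrite e2 rmorphM phi_t mul0r eqxx.
Qed.

End Place.

(* With [tau] a power of a uniformizer, this bounds the order of a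
   differential that is regular at the local ring. *)
Lemma regular_at_local_ring (D : K -> K) (tau : K) g :
  is_derivation iota D -> (forall n, exists n', D (eps n) = tau * eps n') ->
  regular_at D local_ring g -> exists h, local_ring h /\ g = tau * h.
Proof.
move=> Dd Dn [s [sV ->]].
have DV z : local_ring z -> exists h, local_ring h /\ D z = tau * h.
  move=> [n [d [d0 ->]]]; have D0 := local_denom_neq0 d0.
  have [n' en] := Dn n; have [d' ed] := Dn d.
  exists (eps (n' * d - n * d') / eps (d ^+ 2)); split.
    by exists (n' * d - n * d'), (d ^+ 2); rewrite rmorphXn expf_neq0.
  by rewrite (derivation_div _ Dd) // en ed rmorphXn rmorphB !rmorphM; field.
elim: s sV => [|[a b] s IH] sV.
  exists 0; rewrite big_nil mulr0; split=> //.
  by rewrite -(rmorph0 eps); apply: local_ring_eps.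
have [|h [hV hE]] := IH; first by move=> ab abs; apply: sV; rewrite inE abs orbT.
have [/= aV /DV [w [wV wE]]] := sV (a, b) (mem_head _ _).
exists (a * w + h); rewrite big_cons hE wE; split; last by rewrite /=; ring.
by apply: local_ringD => //; apply: local_ringM.
Qed.

End LocalRing.

(** * The rational function field *)

(** An informative existential, because [frac_deriv] computes on the chosen numerator and
    denominator. *)
Lemma frac_quotient (R : idomainType) (x : {fraction R}) :
  {ab : R * R | ab.2 != 0 & x = FracField.tofrac ab.1 / FracField.tofrac ab.2}.
Proof.
elim/quotW: x => x; exists (\n_x, \d_x); first exact: denom_ratioP.
have d0 : FracField.tofrac \d_x != 0 by rewrite tofrac_eq0 denom_ratioP.
apply: (mulIf d0); rewrite divfK // -[X in X * _]/(\pi_{fraction R}%qT x).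
rewrite /GRing.mul /= !piE /FracField.mulf; apply/eqmodP.
rewrite /= FracField.equivfE !numden_Ratio ?mulf_neq0 ?oner_neq0 ?denom_ratioP //.
by rewrite !mulr1 mulrC.
Qed.

(** * Extension of a derivation to fractions by the quotient rule *)

Section FractionDerivation.
Variables (R : idomainType) (F : fieldType) (f : {rmorphism R -> F}).
Hypothesis f_inj : injective f.
Hypothesis quotientP : forall x, {ab : R * R | ab.2 != 0 & x = f ab.1 / f ab.2}.
Variable d : R -> R.
Hypotheses (dD : forall a b, d (a + b) = d a + d b)
  (dM : forall a b, d (a * b) = d a * b + a * d b).

Definition frac_deriv (x : F) : F :=
  let: exist2 ab _ _ := quotientP x in
  f (d ab.1 * ab.2 - ab.1 * d ab.2) / f (ab.2 ^+ 2).

Let f_eq0 a : (f a == 0) = (a == 0).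
Proof. by rewrite -(inj_eq f_inj) rmorph0. Qed.

Lemma frac_deriv_quotient a b : b != 0 ->
  frac_deriv (f a / f b) = f (d a * b - a * d b) / f (b ^+ 2).
Proof.
move=> b0; rewrite /frac_deriv; case: quotientP => -[a' b'] /= b'0.
move/eqP; rewrite eqr_div ?f_eq0 // -!rmorphM (inj_eq f_inj) => /eqP e.
apply/eqP; rewrite eqr_div ?f_eq0 ?expf_neq0 // -!rmorphM (inj_eq f_inj).
have e2 : d (a * b') = d (a' * b) by rewrite e.
rewrite !dM in e2.
have [r1 r2] : a * b' - a' * b = 0
    /\ d a * b' + a * d b' - (d a' * b + a' * d b) = 0 by rewrite e e2 !subrr.
rewrite eq_sym -subr_eq0; apply/eqP.
(* The difference of the cross-multiplied quotients is a combination of the relation a b' = a' b and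
   of its derivative. *)
transitivity (b * b' * (d a * b' + a * d b' - (d a' * b + a' * d b))
  - (a * b' - a' * b) * (d b * b' + d b' * b)); first by ring.
by rewrite r1 r2; ring.
Qed.

Lemma frac_derivD x y : frac_deriv (x + y) = frac_deriv x + frac_deriv y.
Proof.
have [[a b] /= b0 ->] := quotientP x; have [[a' b'] /= b'0 ->] := quotientP y.
have [F0 F'0] : f b != 0 /\ f b' != 0 by rewrite !f_eq0.
rewrite addf_div // -!rmorphM -rmorphD !frac_deriv_quotient ?mulf_neq0 //.
rewrite dD !dM !rmorphXn ?(rmorphB, rmorphD, rmorphM) /=.
by field; rewrite F0 F'0.
Qed.

Lemma frac_derivM x y : frac_deriv (x * y) = frac_deriv x * y + x * frac_deriv y.
Proof.
have [[a b] /= b0 ->] := quotientP x; have [[a' b'] /= b'0 ->] := quotientP y.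
have [F0 F'0] : f b != 0 /\ f b' != 0 by rewrite !f_eq0.
rewrite mulf_div -!rmorphM !frac_deriv_quotient ?mulf_neq0 //.
rewrite !dM !rmorphXn ?(rmorphB, rmorphD, rmorphM) /=.
by field; rewrite F0 F'0.
Qed.

Lemma frac_deriv_embed a : frac_deriv (f a) = f (d a).
Proof.
have d1 : d 1 = 0.
  by have := esym (dM 1 1); rewrite !mulr1 mul1r => /(canRL (addKr _)); rewrite addNr.
have := frac_deriv_quotient a (oner_neq0 R).
by rewrite d1 mulr0 subr0 mulr1 expr1n rmorph1 !divr1.
Qed.

End FractionDerivation.

Section PolynomialEvaluation.
Variables (C K : fieldType) (iota : {rmorphism C -> K}).

Definition peval (u : K) : {poly C} -> K := horner_morph (fun c => mulrC u (iota c)).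

HB.instance Definition _ (u : K) := GRing.RMorphism.copy (peval u)
  (horner_morph (fun c => mulrC u (iota c))).

Lemma pevalC u c : peval u c%:P = iota c.
Proof. exact: horner_morphC. Qed.

Lemma pevalX u : peval u 'X = u.
Proof. exact: horner_morphX. Qed.

Lemma peval_lift (B : comNzRingType) (f : {rmorphism {poly C} -> B})
    (eps : {rmorphism B -> K}) u :
  (forall c, eps (f c%:P) = iota c) -> eps (f 'X) = u ->
  forall p, eps (f p) = peval u p.
Proof.
move=> fC fX; elim/poly_ind => [|p c IH]; first by rewrite !rmorph0.
by rewrite !rmorphD !rmorphM /= IH fC fX pevalC pevalX.
Qed.

Lemma derivation_peval (D : K -> K) u p : is_derivation iota D ->
  D (peval u p) = peval u p^`() * D u.
Proof.
move=> Dd; have [DC DD DM] := Dd.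
elim/poly_ind: p => [|p c IH]; first by rewrite deriv0 !rmorph0 (derivation0 Dd) mul0r.
rewrite derivD derivM derivX derivC addr0 mulr1.
rewrite !(rmorphD, rmorphM) /= pevalX pevalC DD DM DC IH; ring.
Qed.

(** [polyrev 4] is convertible to [reciprocal4]. The bound n may exceed the degree, so that a
    numerator and a denominator can be reversed with the same power of u, which then cancels. *)
Definition polyrev n (p : {poly C}) : {poly C} := \poly_(i < n.+1) p`_(n - i).

Lemma peval_polyrev n (p : {poly C}) u : (size p <= n.+1)%N -> u != 0 ->
  peval u^-1 (polyrev n p) = peval u p / u ^+ n.
Proof.
move=> sp u0.
have E (v : K) (q : {poly C}) : (size q <= n.+1)%N ->
    peval v q = \sum_(i < n.+1) iota q`_i * v ^+ i.
  move=> sq; rewrite /peval /horner_morph (horner_coef_wide (n := n.+1)).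
    by apply: eq_bigr => i _; rewrite coef_map.
  by rewrite size_map_poly.
rewrite !E // ?size_poly // mulr_suml (reindex_inj rev_ord_inj).
apply: eq_bigr => i _; have le : (i <= n)%N by rewrite -ltnS.
rewrite coef_poly /= subSS ltnS leq_subr subKn // -mulrA; congr (_ * _).
apply: (mulIf (expf_neq0 n u0)); rewrite divfK ?expf_neq0 //.
have -> : u ^+ n = u ^+ (n - i) * u ^+ i by rewrite -exprD subnK.
by rewrite mulrA -exprMn mulVf // expr1n mul1r.
Qed.

Lemma polyrev_eq0 n (p : {poly C}) : (size p <= n.+1)%N -> polyrev n p = 0 -> p = 0.
Proof.
move=> sp p0; apply/polyP => i; rewrite coef0; case: (ltnP i n.+1) => ni.
  have := congr1 (fun q : {poly C} => q`_(n - i)) p0.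
  by rewrite coef_poly coef0 ltnS leq_subr subKn.
by rewrite nth_default // (leq_trans sp).
Qed.

Lemma polyrev_at0 n p : (polyrev n p).[0] = p`_n.
Proof. by rewrite horner_coef0 coef_poly /= subn0. Qed.

End PolynomialEvaluation.

Section DerivationExtension.
Variables (C K : fieldType) (A : comNzRingType).
Variables (iota : {rmorphism C -> K}) (eps : {rmorphism A -> K}).
Hypothesis eps_inj : injective eps.
Hypothesis eps_gen : forall z, exists n d, d != 0 /\ z = eps n / eps d.

Lemma derivation_ext (D1 D2 : K -> K) h :
  is_derivation iota D1 -> is_derivation iota D2 ->
  (forall n, D1 (eps n) = h * D2 (eps n)) -> forall z, D1 z = h * D2 z.
Proof.
move=> D1d D2d e z; have [n [d [d0 ->]]] := eps_gen z.
have D0 : eps d != 0 by rewrite -(rmorph0 eps) (inj_eq eps_inj).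
by rewrite (derivation_div _ D1d) // (derivation_div _ D2d) // !e; field.
Qed.

End DerivationExtension.

Section RationalFunctions.
Variables (C : closedFieldType) (K : fieldType) (iota : {rmorphism C -> K}).
Local Notation ev := (peval iota).

Lemma peval_eq0 u p : injective (ev u) -> (ev u p == 0) = (p == 0).
Proof. by move=> u_inj; rewrite -(inj_eq u_inj) rmorph0. Qed.

Lemma transcendental_neq0 u : injective (ev u) -> u != 0.
Proof. by move=> u_inj; rewrite -[u in u != _](pevalX iota) peval_eq0 // polyX_eq0. Qed.

Lemma peval_inv_inj u : injective (ev u) -> injective (ev u^-1).
Proof.
move=> u_inj; have u0 := transcendental_neq0 u_inj.
apply: raddf_inj => p p0; apply: (@polyrev_eq0 _ (size p)) => //.
apply/eqP; rewrite -(peval_eq0 _ u_inj); apply/eqP.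
have := @peval_polyrev _ _ iota (size p) p u^-1.
rewrite invrK invr_eq0 => -> //; first by rewrite p0 mul0r.
Qed.

Lemma rational_inv u p r : injective (ev u) -> r != 0 ->
  exists p' r', r' != 0 /\ ev u p / ev u r = ev u^-1 p' / ev u^-1 r'.
Proof.
move=> u_inj r0; have u0 := transcendental_neq0 u_inj.
pose n := maxn (size p) (size r).
have sp : (size p <= n.+1)%N by rewrite leqW // leq_maxl.
have sr : (size r <= n.+1)%N by rewrite leqW // leq_maxr.
exists (polyrev n p), (polyrev n r); split.
  by apply: contraNneq r0 => h; rewrite (polyrev_eq0 sr h).
rewrite !peval_polyrev // invf_div mulrA divfK ?expf_neq0 //.
Qed.

(** Each root of the denominator is a root of the numerator, so linear factors cancel until the
    denominator is constant. The hypothesis ranges over all representations of f, hence survives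
    each cancellation. *)
Lemma rational_polynomial u f : injective (ev u) ->
  (exists p r, r != 0 /\ f = ev u p / ev u r) ->
  (forall a p r, r != 0 -> f = ev u p / ev u r -> root r a -> root p a) ->
  exists p, f = ev u p.
Proof.
move=> u_inj [p [r [r0 fE]]] fH.
have [n] := ubnP (size r); elim: n p r r0 fE => // n IH p r r0 fE sr.
have [/size_poly1P [c c0 rE]|/closed_rootP [a ra]] := boolP (size r == 1%N).
  exists (p * c^-1%:P); rewrite fE rE rmorphM /= !pevalC fmorphV //.
have pa := fH _ _ _ r0 fE ra.
have [r1 r1E] := factor_theorem _ _ ra; have [p1 p1E] := factor_theorem _ _ pa.
have xa : ev u ('X - a%:P) != 0 by rewrite peval_eq0 // polyXsubC_eq0.
have r10 : r1 != 0 by apply: contraNneq r0 => h; rewrite r1E h mul0r.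
apply: (IH p1 r1) => //.
  by rewrite fE r1E p1E !rmorphM /= -mulf_div divff // mulr1.
move: sr; rewrite r1E size_Mmonic ?monicXsubC // size_XsubC addn2 /=.
by rewrite ltnS.
Qed.

(* A rational function without poles on the projective line is constant. *)
Lemma rational_const u f : injective (ev u) ->
  (exists p r, r != 0 /\ f = ev u p / ev u r) ->
  (forall a p r, r != 0 -> f = ev u p / ev u r -> root r a -> root p a) ->
  (forall p r, r != 0 -> f = ev u^-1 p / ev u^-1 r -> root r 0 -> root p 0) ->
  exists c, f = iota c.
Proof.
move=> u_inj fE fH fI; have u0 := transcendental_neq0 u_inj.
have [p {}fE] := rational_polynomial u_inj fE fH.
have [sp|sp] := leqP (size p) 1.
  by exists p`_0; rewrite fE {1}(size1_polyC sp) pevalC.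
have [m mE] : exists m, size p = m.+2 by case: (size p) sp => [|[|m]] // _; exists m.
(* For p of degree m+1 > 0, f is the reversal of p at 1/u divided by (1/u)^(m+1). Having no pole at
   infinity makes the reversal vanish at 0, where its value is the leading coefficient of p. *)
have : root (polyrev m.+1 p) 0.
  apply: (fI _ 'X^(m.+1)); last 1 first.
  - by rewrite rootE hornerXn expr0n.
  - by rewrite monic_neq0 ?monicXn.
  rewrite peval_polyrev ?mE // rmorphXn /= pevalX exprVn -fE invrK.
  by rewrite divfK ?expf_neq0.
rewrite rootE polyrev_at0 -[m.+1]/(m.+2.-1) -mE -lead_coefE lead_coef_eq0.
by move=> /eqP p0; rewrite p0 size_poly0 in sp.
Qed.

(** Turns membership in a local ring into the pole condition of [rational_const]: cross-multiply
    inside A, then evaluate at the point. *)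
Lemma local_ring_root (A : comNzRingType) (eps : {rmorphism A -> K})
    (phi : {rmorphism A -> C}) (j : {rmorphism {poly C} -> A}) u a p r :
  injective eps -> (forall p, eps (j p) = ev u p) -> (forall p, phi (j p) = p.[a]) ->
  injective (ev u) -> local_ring eps phi (ev u p / ev u r) -> r != 0 ->
  root r a -> root p a.
Proof.
move=> eps_inj eps_j phi_j u_inj [n [d [d0 e]]] r0 ra.
have R0 : ev u r != 0 by rewrite peval_eq0.
have E0 := local_denom_neq0 eps_inj d0.
move/eqP: e; rewrite eqr_div // -!eps_j -!rmorphM => /eqP /eps_inj e.
have := congr1 phi e; rewrite !rmorphM /= !phi_j (eqP ra) mulr0 => /eqP.
by rewrite mulf_eq0 (negPf d0) orbF.
Qed.

Lemma polynomial_place u a : injective (ev u) ->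
  (forall z, exists p r, r != 0 /\ z = ev u p / ev u r) ->
  is_place iota (local_ring (ev u) (horner_eval a)).
Proof.
move=> u_inj gen.
apply: (@local_ring_is_place _ _ _ iota (ev u) (horner_eval a) _ ('X - a%:P)) => //.
- by rewrite polyXsubC_eq0.
- by rewrite /= /horner_eval hornerXsubC subrr.
- move=> n n0; have /factor_theorem [n' ->] : root n a by exact/eqP.
  by exists 1, n'; rewrite rmorph1 oner_neq0; split=> //; ring.
- move=> n n0; have [m [w wa e]] := multiplicity_XsubC n a.
  by exists 1, m, w; split; [move: wa; rewrite n0 | rewrite e; ring].
- by move=> c; exists c%:P; apply: pevalC.
Qed.

(** * Regular differentials on the projective line *)

Section GenusZero.
Variables (u : K) (D : K -> K).
Hypothesis u_inj : injective (ev u).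
Hypothesis gen : forall z, exists p r, r != 0 /\ z = ev u p / ev u r.
Hypotheses (D_der : is_derivation iota D) (Du : D u = 1).

Lemma rational_derivation_basis : derivation_basis iota D.
Proof.
split=> //; first by exists u; rewrite Du; apply/eqP/oner_neq0.
move=> D' D'_der; exists (D' u) => z.
apply: (derivation_ext u_inj gen D'_der D_der) => p.
by rewrite !derivation_peval // Du mulr1 mulrC.
Qed.

Lemma rational_regular_differential g : regular_differential iota D g -> g = 0.
Proof.
move=> gr; have u0 := transcendental_neq0 u_inj; have v_inj := peval_inv_inj u_inj.
have gena z : exists p r, r != 0 /\ z = ev u^-1 p / ev u^-1 r.
  by have [p [r [r0 ->]]] := gen z; apply: rational_inv.
have fin a : local_ring (ev u) (horner_eval a) g.
  have [h [hV ->]] : exists h, local_ring (ev u) (horner_eval a) h /\ g = 1 * h.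
    apply: (regular_at_local_ring u_inj D_der); last exact/gr/polynomial_place.
    by move=> n; exists n^`(); rewrite derivation_peval // Du; ring.
  by rewrite mul1r.
have inf : exists h, local_ring (ev u^-1) (horner_eval 0) h /\ g = - u^-1 ^+ 2 * h.
  apply: (regular_at_local_ring v_inj D_der); last exact/gr/polynomial_place.
  move=> n; exists n^`(); rewrite derivation_peval //.
  have := derivation_div 1 D_der u0; rewrite div1r (derivation1 D_der) Du => ->.
  by field.
have [h [hV gE]] := inf.
have gV : local_ring (ev u^-1) (horner_eval 0) g.
  rewrite gE; apply: local_ringM => //; exists (- 'X^2), 1.
  by rewrite !rmorph1 oner_neq0 divr1 rmorphN rmorphXn /= pevalX.
have [c cE] : exists c, g = iota c.
  apply: (rational_const u_inj); first exact: gen.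
    move=> a p r r0 e; apply: (@local_ring_root _ (ev u) (horner_eval a) idfun u) => //.
    by rewrite -e.
  move=> p r r0 e; apply: (@local_ring_root _ (ev u^-1) (horner_eval 0) idfun u^-1) => //.
  by rewrite -e.
have [c0|c0] := eqVneq c 0; first by rewrite cE c0 rmorph0.
have [n [d [d0 hE]]] := hV.
have E0 := local_denom_neq0 v_inj d0.
(* Clearing denominators in c = - u^-2 h; at 1/u = 0 the right side vanishes while c and d(0) do
   not. *)
have : c%:P * d = - 'X^2 * n.
  apply: v_inj; rewrite !rmorphM rmorphN rmorphXn /= pevalC pevalX -cE gE hE.
  by field; rewrite E0 u0.
move/(congr1 (fun p : {poly C} => p.[0])); rewrite !hornerE expr0n /= => /eqP.
by rewrite oppr0 mul0r mulf_eq0 (negPf c0) (negPf d0).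
Qed.

End GenusZero.

End RationalFunctions.

(** * Genus one *)

Section Separable.
Variables (C : closedFieldType) (q : {poly C}).
Hypothesis q_sep : forall x, root q x -> ~~ root q^`() x.
Hypothesis q_nconst : size q != 1%N.

Lemma separable_neq0 : q != 0.
Proof.
apply: contraPneq (@q_sep 0) => ->; rewrite deriv0 root0.
by move/(_ isT).
Qed.

Lemma separable_factor x : root q x ->
  exists2 q1, q = q1 * ('X - x%:P) & ~~ root q1 x.
Proof.
move=> qx; have := q_sep qx; have [q1 ->] := factor_theorem _ _ qx.
rewrite derivM derivXsubC mulr1 rootE hornerD hornerM hornerXsubC subrr mulr0 add0r.
by exists q1.
Qed.

(** At a root of q, which is simple, the two sides would have multiplicities of different parity. *)
Lemma separable_not_square a b : a ^+ 2 = q * b ^+ 2 -> b = 0.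
Proof.
have [x qx] := closed_rootP _ q_nconst; have [q1 qE q1x] := separable_factor qx.
have q0 := separable_neq0.
move=> e; apply/eqP; apply: contraT => b0.
have a0 : a != 0.
  by apply: contra_eq_neq e => ->; rewrite expr0n eq_sym mulf_neq0 ?expf_neq0.
have := congr1 (mup x) e; rewrite !expr2 !mupM ?mulf_neq0 //.
have -> : mup x q = 1%N.
  by rewrite qE mupMr // -[_ - _]expr1 mup_XsubCX eqxx.
by move/(congr1 odd); rewrite !addnn oddD !odd_double.
Qed.

Lemma quad_poly_norm_eq0 (n : quad q) : quad_norm n = 0 -> n = 0.
Proof.
case: n => a b; rewrite /quad_norm /= => /eqP; rewrite subr_eq0 => /eqP e.
have b0 := separable_not_square e; apply/eqP; rewrite quad_eq0 /= b0 eqxx andbT.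
by move: e; rewrite b0 expr0n mulr0 => /eqP; rewrite sqrf_eq0.
Qed.

End Separable.

(** * Local rings and differentials on one affine chart y^2 = q(u) *)

Section Chart.
Variables (C : closedFieldType) (K : fieldType) (iota : {rmorphism C -> K}).
Hypothesis two_neq0 : 2%:R != 0 :> C.
Local Notation ev := (peval iota).
Variables (u y : K) (q : {poly C}).
Hypothesis u_inj : injective (ev u).
Hypothesis q_sep : forall x, root q x -> ~~ root q^`() x.
Hypothesis q_nconst : size q != 1%N.
Hypothesis y2 : y ^+ 2 = ev u q.
Hypothesis gen : forall z, exists a b c d,
  [/\ b != 0, d != 0 & z = ev u a / ev u b + ev u c / ev u d * y].

Local Notation eps := (quad_lift y2).

(** The norm of an element of the kernel is a polynomial killed by evaluation at the transcendental
    u, hence zero. *)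
Lemma quad_lift_inj : injective eps.
Proof.
apply: raddf_inj => n n0; apply: (quad_poly_norm_eq0 q_sep q_nconst).
apply: u_inj; rewrite -(quad_liftC y2) -quad_mul_conj rmorphM /=.
by rewrite n0 mul0r !rmorph0.
Qed.

Lemma quad_gen z : exists n d : quad q, d != 0 /\ z = eps n / eps d.
Proof.
have [a [b [c [d [b0 d0 ->]]]]] := gen z.
exists (a * d, b * c), (quadC q (b * d)).
have B0 : ev u b != 0 by rewrite peval_eq0.
have D0 : ev u d != 0 by rewrite peval_eq0.
split; first by rewrite quad_eq0 /= eqxx andbT mulf_neq0.
by rewrite quad_liftC /quad_lift /= !rmorphM; field; rewrite B0 D0.
Qed.

Section Point.
Variables a b : C.
Hypothesis ab : b ^+ 2 = horner_eval a q.
Local Notation phi := (quad_lift ab).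

Let phiE (n : quad q) : phi n = n.1.[a] + n.2.[a] * b.
Proof. by []. Qed.

(** At a branch point q = q1 (u - a) with q1(a) nonzero, so u - a = y^2 / q1 has order two and y
    replaces it. *)
Definition uniformizer : quad q :=
  if b == 0 then quad_root q else quadC q ('X - a%:P).

Lemma uniformizer_eval : phi uniformizer = 0.
Proof.
rewrite /uniformizer; have [b0|b0] := eqVneq b 0.
  by rewrite quad_lift_root.
by rewrite quad_liftC /= /horner_eval hornerXsubC subrr.
Qed.

Lemma uniformizer_neq0 : uniformizer != 0.
Proof.
rewrite /uniformizer quad_eq0; case: ifP => _ /=.
  by rewrite oner_eq0 andbF.
by rewrite polyXsubC_eq0.
Qed.

Lemma branch_factor : b = 0 ->
  exists2 q1, q = q1 * ('X - a%:P) & q1.[a] != 0.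
Proof.
move=> b0; apply: separable_factor => //.
by rewrite rootE -[q.[a]]/(horner_eval a q) -ab b0 expr0n.
Qed.

Lemma uniformizer_div n : phi n = 0 ->
  exists s n', phi s != 0 /\ s * n = uniformizer * n'.
Proof.
case: n => n1 n2; rewrite phiE /= /uniformizer.
have [b0|b0] := eqVneq b 0.
  have [q1 qE q1a] := branch_factor b0.
  have -> : n1.[a] + n2.[a] * b = n1.[a] by rewrite b0 mulr0 addr0.
  move=> /eqP/factor_theorem [m mE].
  (* Multiplication by the local unit q1 turns u - a into q = y^2, so a factor y comes out of both
     terms of n. *)
  exists (quadC q q1), (q1 * n2, m); rewrite quad_liftC; split=> //.
  rewrite !quad_mulE /=; congr (_, _); last by ring.
  by rewrite mE {2}qE; ring.
move/eqP; rewrite addr_eq0 => /eqP n0.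
(* Multiplying n by b + y, whose value 2 b is nonzero, gives coordinates b n1 + q n2 and n1 + b n2,
   and both vanish at a. *)
have /eqP/factor_theorem [m1 m1E] : (b%:P * n1 + q * n2).[a] = 0.
  rewrite !hornerE n0 -[q.[a]]/(horner_eval a q) -ab; ring.
have /eqP/factor_theorem [m2 m2E] : (n1 + b%:P * n2).[a] = 0.
  by rewrite !hornerE n0; ring.
exists (b%:P, 1), (m1, m2); split.
  by rewrite phiE /= !hornerE -mulr2n -mulr_natr mulf_neq0.
rewrite !quad_mulE /=; congr (_, _).
  by rewrite mul1r m1E; ring.
by rewrite mul1r addrC m2E; ring.
Qed.

(** The product of n with its conjugate lies in C[u], where the multiplicity m at a is defined. At a
    branch point the extra factor q1^m makes q^m = y^(2m) out of (u - a)^m. *)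
Lemma uniformizer_fin n : n != 0 ->
  exists c m w, phi w != 0 /\ n * c = uniformizer ^+ m * w.
Proof.
move=> n0; have N0 : quad_norm n != 0.
  by apply: contraNneq n0 => /(quad_poly_norm_eq0 q_sep q_nconst) ->.
have [m [w wa e]] := multiplicity_XsubC (quad_norm n) a; rewrite N0 /= in wa.
rewrite /uniformizer; have [b0|b0] := eqVneq b 0.
  have [q1 qE q1a] := branch_factor b0.
  exists (quad_conj n * quadC q (q1 ^+ m)), m.*2, (quadC q w).
  rewrite quad_liftC; split=> //.
  rewrite mulrA quad_mul_conj -mul2n exprM quad_root_sqr -!rmorphXn -!rmorphM /=.
  by congr quadC; rewrite e {1}qE exprMn; ring.
exists (quad_conj n), m, (quadC q w); rewrite quad_liftC; split=> //.
by rewrite quad_mul_conj e -rmorphXn -rmorphM /= mulrC.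
Qed.

Lemma quad_place : is_place iota (local_ring eps phi).
Proof.
apply: (local_ring_is_place quad_lift_inj uniformizer_neq0 uniformizer_eval
  uniformizer_div uniformizer_fin); last exact: quad_gen.
by move=> c; exists (quadC q c%:P); rewrite /= quad_liftC /= pevalC.
Qed.

End Point.

Section Derivation.
Variable D : K -> K.
Hypotheses (D_der : is_derivation iota D) (Du : D u = y)
  (Dy : D y *+ 2 = ev u q^`()).

(** D (n1 + n2 y) = n1' y + n2' q + n2 q' / 2, so [regular_at_local_ring] applies with tau = 1. *)
Lemma derivation_quad n : exists n', D (eps n) = eps n'.
Proof.
have [_ DD DM] := D_der.
have K2 : iota 2%:R != 0 by rewrite fmorph_eq0.
exists (q * n.2^`() + (2%:R^-1)%:P * n.2 * q^`(), n.1^`()).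
rewrite /quad_lift DD DM !(derivation_peval _ _ D_der) Du /=.
rewrite !(rmorphD, rmorphM) /= pevalC -y2 -Dy fmorphV rmorph_nat.
rewrite rmorph_nat in K2.
by field.
Qed.

Lemma regular_at_finite_place a b (ab : b ^+ 2 = horner_eval a q) g :
  regular_differential iota D g -> local_ring eps (quad_lift ab) g.
Proof.
move=> gr.
have [h [hV ->]] : exists h, local_ring eps (quad_lift ab) h /\ g = 1 * h.
  apply: (regular_at_local_ring quad_lift_inj D_der); last exact/gr/quad_place.
  by move=> n; have [n' ->] := derivation_quad n; exists n'; rewrite mul1r.
by rewrite mul1r.
Qed.

Lemma regular_one_finite V : is_place iota V -> V u -> regular_at D V 1.
Proof.
move=> [VC VB VM Vinv _] Vu.
have V0 : V 0 by rewrite -(rmorph0 iota).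
have VD a b : V a -> V b -> V (a + b).
  move=> Va Vb; rewrite -[b]opprK; apply: (VB) => //.
  by rewrite -[- b]add0r; apply: VB.
have Vev p : V (ev u p).
  elim/poly_ind: p => [|p c IH]; first by rewrite rmorph0.
  rewrite rmorphD rmorphM /= pevalX pevalC; apply: VD => //; exact: VM.
(* If V contains the inverse of y instead, then y = q(u) y^-1 is in V as well. *)
have Vy : V y.
  have [//|Vy1] := Vinv y; have [->//|y0] := eqVneq y 0.
  by rewrite -[y](mulfK y0) -expr2 y2; apply: (VM).
have : coprimep q q^`() by apply/Pdiv.ClosedField.coprimepP => x /q_sep.
case/Bezout_eq1_coprimepP => -[A B] /= AB.
(* In A q + B q' = 1, the terms are A q = (A y) D u and B q' = (2 B) D y. *)
exists [:: (ev u A * y, u); (ev u (B *+ 2), y)]; split.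
  by move=> ab; rewrite !inE => /orP [] /eqP -> /=; split=> //; apply: VM.
rewrite !big_cons big_nil /= Du -(rmorph1 (ev u)) -AB rmorphD !rmorphM rmorphMn.
by rewrite /= -y2 -Dy; ring.
Qed.

Variable sigma : {rmorphism K -> K}.
Hypotheses (sigma_iota : forall c, sigma (iota c) = iota c)
  (sigma_u : sigma u = u) (sigma_y : sigma y = - y).

(** Conjugation exchanges the points (a, b) and (a, -b), so regularity of g at the second gives the
    claim at the first. *)
Lemma regular_conj_finite a b (ab : b ^+ 2 = horner_eval a q) g :
  regular_differential iota D g -> local_ring eps (quad_lift ab) (sigma g).
Proof.
have ab' : (- b) ^+ 2 = horner_eval a q by rewrite sqrrN.
move=> /(regular_at_finite_place ab') [n [d [d0 ->]]].
have sE m : sigma (eps m) = eps (quad_conj m).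
  rewrite /quad_lift rmorphD rmorphM sigma_y /=.
  have sev p : sigma (ev u p) = ev u p.
    by apply: (@peval_lift _ _ _ _ (ev u) sigma) => [c|] /=; rewrite ?pevalC ?pevalX.
  by rewrite !sev rmorphN; ring.
exists (quad_conj n), (quad_conj d); rewrite fmorph_div !sE; split=> //.
by move: d0; rewrite /= /quad_lift /= rmorphN mulrN mulNr.
Qed.

(** Since C is algebraically closed, some point (a, b) lies above each a, and a pole at a would be
    seen there. *)
Lemma rational_pole_finite f :
  (forall a b (ab : b ^+ 2 = horner_eval a q), local_ring eps (quad_lift ab) f) ->
  forall a p r, r != 0 -> f = ev u p / ev u r -> root r a -> root p a.
Proof.
move=> fV a p r r0 fE; have [b] : exists b, root ('X^2 - (q.[a])%:P) b.
  by apply/closed_rootP; rewrite size_XnsubC.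
rewrite rootE !hornerE subr_eq0 -[q.[a]]/(horner_eval a q) => /eqP ab.
move=> ra; refine (@local_ring_root _ _ iota _ eps (quad_lift ab)
  (@quadC _ q) u a p r _ _ _ u_inj _ r0 ra) => //.
- exact: quad_lift_inj.
- by move=> n; rewrite /= quad_liftC.
- by move=> n; rewrite /= quad_liftC.
- by rewrite -fE.
Qed.

End Derivation.
End Chart.

(** * Both charts together: global regular differentials *)

Section GenusOne.
Variables (C : closedFieldType) (K : fieldType) (iota : {rmorphism C -> K}).
Hypothesis two_neq0 : 2%:R != 0 :> C.
Local Notation ev := (peval iota).
Variables (u y : K) (q : {poly C}).
Hypothesis u_inj : injective (ev u).
Hypothesis q_size : (size q <= 5)%N.
Hypothesis q_nconst : size q != 1%N.
Hypothesis q_sep : forall x, root q x -> ~~ root q^`() x.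
Hypothesis q_sep_inf :
  forall x, root (reciprocal4 q) x -> ~~ root (reciprocal4 q)^`() x.
Hypothesis y2 : y ^+ 2 = ev u q.
Hypothesis gen : forall z, exists a b c d,
  [/\ b != 0, d != 0 & z = ev u a / ev u b + ev u c / ev u d * y].
Variable D : K -> K.
Hypotheses (D_der : is_derivation iota D) (Du : D u = y)
  (Dy : D y *+ 2 = ev u q^`()).

Let u0 : u != 0. Proof. exact: transcendental_neq0 u_inj. Qed.
Let v := u^-1.
(** The sign is the one for which D v = z. *)
Let z := - y / u ^+ 2.
Let v_inj : injective (ev v). Proof. exact: peval_inv_inj. Qed.

Lemma ordinate_neq0 : y != 0.
Proof.
rewrite -sqrf_eq0 y2 peval_eq0 //; exact: separable_neq0.
Qed.

Lemma infinity_eqn : z ^+ 2 = ev v (reciprocal4 q).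
Proof. by rewrite -[reciprocal4 q]/(polyrev 4 q) peval_polyrev // -y2 /z; field. Qed.

(** If the reversal were constant, the coefficients of q in degrees 0 and 1 would vanish and 0 would
    be a double root of q. *)
Lemma infinity_nconst : size (reciprocal4 q) != 1%N.
Proof.
apply/negP => /eqP s1; have := q_sep (x := 0).
have c0 i : (0 < i < 5)%N -> q`_(4 - i) = 0.
  move=> /andP [i0 i5]; have : (reciprocal4 q)`_i = 0 by rewrite nth_default // s1.
  by rewrite coef_poly i5.
have /= q0 := c0 4 isT; have /= q1 := c0 3 isT.
by rewrite !rootE !horner_coef0 coef_deriv q0 q1 mul0rn eqxx => /(_ isT).
Qed.

Lemma infinity_gen w : exists a b c d,
  [/\ b != 0, d != 0 & w = ev v a / ev v b + ev v c / ev v d * z].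
Proof.
have [a [b [c [d [b0 d0 ->]]]]] := gen w.
have [a' [b' [b'0 ->]]] := rational_inv a u_inj b0.
have [c' [d' [d'0 ->]]] := rational_inv c u_inj d0.
exists a', b', (- c'), (d' * 'X^2); split=> //.
  by rewrite mulf_neq0 // monic_neq0 ?monicXn.
have D0 : ev v d' != 0 by rewrite peval_eq0.
have B0 : ev v b' != 0 by rewrite peval_eq0.
rewrite rmorphM rmorphN rmorphXn /= pevalX -/v /z.
have -> : u = v^-1 by rewrite invrK.
have v0 : v != 0 by rewrite invr_eq0.
by field; rewrite v0 oner_neq0 D0 B0.
Qed.

Lemma infinity_Dv : D v = z.
Proof.
have := derivation_div 1 D_der u0; rewrite div1r (derivation1 D_der) Du => ->.
by rewrite mul0r mul1r sub0r.
Qed.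

(** Differentiating the equation of the chart and cancelling z avoids computing the derivative of a
    reversed polynomial. *)
Lemma infinity_Dz : D z *+ 2 = ev v (reciprocal4 q)^`().
Proof.
have [_ _ DM] := D_der.
have z0 : z != 0 by rewrite mulf_neq0 ?invr_eq0 ?expf_neq0 ?oppr_eq0 ?ordinate_neq0.
have := congr1 D infinity_eqn; rewrite derivation_peval // infinity_Dv expr2 DM => e.
by apply: (mulIf z0); rewrite -e; ring.
Qed.

Lemma regular_differential_one : regular_differential iota D 1.
Proof.
move=> V Vp; have [_ _ _ Vinv _] := Vp; case: (Vinv u) => Vu.
  exact: (regular_one_finite q_sep y2 Du Dy Vp Vu).
exact: (regular_one_finite q_sep_inf infinity_eqn infinity_Dv infinity_Dz Vp Vu).
Qed.

Variable sigma : {rmorphism K -> K}.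
Hypotheses (sigma_iota : forall c, sigma (iota c) = iota c)
  (sigma_u : sigma u = u) (sigma_y : sigma y = - y).

Let sigma_v : sigma v = v. Proof. by rewrite fmorphV sigma_u. Qed.
Let sigma_z : sigma z = - z.
Proof. by rewrite /z fmorph_div rmorphN rmorphXn sigma_u sigma_y /= mulNr. Qed.

Lemma regular_differential_const g : regular_differential iota D g ->
  exists c, g = iota c.
Proof.
move=> gr.
have sev p : sigma (ev u p) = ev u p.
  by apply: (@peval_lift _ _ _ _ (ev u) sigma) => [c|] /=; rewrite ?pevalC ?pevalX.
pose V a b (ab : b ^+ 2 = horner_eval a q) := local_ring (quad_lift y2) (quad_lift ab).
pose W a b (ab : b ^+ 2 = horner_eval a (reciprocal4 q)) :=
  local_ring (quad_lift infinity_eqn) (quad_lift ab).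
have gV a b ab : @V a b ab g.
  exact: (regular_at_finite_place two_neq0 u_inj q_sep q_nconst y2 gen D_der Du Dy).
have sV a b ab : @V a b ab (sigma g).
  exact: (regular_conj_finite two_neq0 u_inj q_sep q_nconst y2 gen D_der Du Dy
    sigma_iota sigma_u sigma_y).
have gW a b ab : @W a b ab g.
  exact: (regular_at_finite_place two_neq0 v_inj q_sep_inf infinity_nconst
    infinity_eqn infinity_gen D_der infinity_Dv infinity_Dz).
have sW a b ab : @W a b ab (sigma g).
  exact: (regular_conj_finite two_neq0 v_inj q_sep_inf infinity_nconst
    infinity_eqn infinity_gen D_der infinity_Dv infinity_Dz
    sigma_iota sigma_v sigma_z).
have const f : (exists p r, r != 0 /\ f = ev u p / ev u r) ->
    (forall a b ab, @V a b ab f) -> (forall a b ab, @W a b ab f) ->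
    exists c, f = iota c.
  move=> fE fV fW; apply: (rational_const u_inj) => //.
    exact: (rational_pole_finite u_inj q_sep q_nconst fV).
  exact: (rational_pole_finite v_inj q_sep_inf infinity_nconst fW).
have eps_inj := quad_lift_inj u_inj q_sep q_nconst (y2 := y2).
have eps_inj' := quad_lift_inj v_inj q_sep_inf infinity_nconst (y2 := infinity_eqn).
have [a [b [c [d [b0 d0 gE]]]]] := gen g.
have B0 : ev u b != 0 by rewrite peval_eq0.
have D0 : ev u d != 0 by rewrite peval_eq0.
have sgE : sigma g = ev u a / ev u b - ev u c / ev u d * y.
  by rewrite gE rmorphD !rmorphM !fmorphV /= !sev sigma_y mulrN.
have [t tE] : exists t, g + sigma g = iota t.
  apply: const => [||].
  - exists (a *+ 2), b; split=> //; rewrite sgE gE rmorphMn /=; ring.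
  - by move=> a' b' ab; apply: (local_ringD eps_inj (gV _ _ _) (sV _ _ _)).
  - by move=> a' b' ab; apply: (local_ringD eps_inj' (gW _ _ _) (sW _ _ _)).
have [n nE] : exists n, g * sigma g = iota n.
  apply: const => [||].
  - exists (a ^+ 2 * d ^+ 2 - c ^+ 2 * b ^+ 2 * q), (b ^+ 2 * d ^+ 2).
    rewrite mulf_neq0 ?expf_neq0 //; split=> //.
    rewrite sgE gE rmorphB !(rmorphXn, rmorphM) /= -y2.
    by field; rewrite B0 D0.
  - by move=> a' b' ab; apply: (local_ringM eps_inj (gV _ _ _) (sV _ _ _)).
  - by move=> a' b' ab; apply: (local_ringM eps_inj' (gW _ _ _) (sW _ _ _)).
(* g is a root of T^2 - t T + n, which splits over C as (T - r)(T - (t - r)); so g is r or t - r. *)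
have [r] : exists r, root ('X^2 - t *: 'X + n%:P) r.
  apply/closed_rootP; rewrite -addrA size_polyDl size_polyXn //.
  apply: leq_ltn_trans (size_polyD _ _) _; rewrite gtn_max size_polyN.
  rewrite (leq_ltn_trans (size_scale_leq _ _)) ?size_polyX //.
  by rewrite (leq_ltn_trans (size_polyC_leq1 _)).
rewrite rootE !hornerE => /eqP rE.
have : (g - iota r) * (g - (iota t - iota r)) = 0.
  transitivity (- iota (r ^+ 2 - t * r + n)); last by rewrite rE rmorph0 oppr0.
  by rewrite rmorphD rmorphB rmorphXn rmorphM -nE -tE; ring.
move/eqP; rewrite mulf_eq0 !subr_eq0 => /orP [] /eqP ->; first by exists r.
by exists (t - r); rewrite rmorphB.
Qed.

Lemma genus_one_differentials :
  regular_differentials_basis iota D (fun _ : 'I_1 => 1).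
Proof.
split=> [_|g /regular_differential_const [c ->]]; first exact: regular_differential_one.
exists [ffun=> c]; split; first by rewrite big_ord1 ffunE mulr1.
move=> c' /esym; rewrite big_ord1 mulr1 => /fmorph_inj e.
by apply/ffunP => i; rewrite ffunE ord1.
Qed.

(** A derivation is determined by its value at u, because y^2 = q(u) gives 2 y D' y = q'(u) D' u. *)
Lemma genus_one_derivation_basis : derivation_basis iota D.
Proof.
split=> //; first by exists u; rewrite Du; apply/eqP/ordinate_neq0.
move=> D' D'_der; exists (D' u / y).
have y0 := ordinate_neq0.
have K2 : (2%:R : K) != 0 by rewrite -(rmorph_nat iota) fmorph_eq0.
have D'y : D' y = D' u / y * D y.
  have := congr1 D' y2; rewrite (derivation_peval _ _ D'_der) -Dy.
  have [_ _ DM] := D'_der; rewrite expr2 DM => e.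
  apply: (mulIf (mulf_neq0 K2 y0)); transitivity (D' y * y + y * D' y); first by ring.
  by rewrite e; field.
apply: (derivation_ext (quad_lift_inj u_inj q_sep q_nconst (y2 := y2)) _ D'_der D_der).
  exact: quad_gen.
have [_ DD' DM'] := D'_der; have [_ DD DM] := D_der.
move=> n; rewrite /quad_lift DD' DD DM' DM.
by rewrite !(derivation_peval _ _ D'_der, derivation_peval _ _ D_der) D'y Du; field.
Qed.

End GenusOne.

(** * Function fields *)

Lemma rmorph_mmap n (R B B' : comNzRingType) (g : {rmorphism B -> B'})
    (j : R -> B) (j' : R -> B') (h : 'I_n -> B) (h' : 'I_n -> B') p :
  (forall c, g (j c) = j' c) -> (forall i, g (h i) = h' i) ->
  g (mmap j h p) = mmap j' h' p.
Proof.
move=> gj gh; rewrite /mmap rmorph_sum; apply: eq_bigr => m _.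
rewrite rmorphM gj /mmap1 rmorph_prod; congr (_ * _).
by apply: eq_bigr => i _; rewrite rmorphXn /= gh.
Qed.

Lemma mmap_horner_alg (C K : fieldType) n (iota : {rmorphism C -> K})
    (x : 'I_n -> K) i a :
  mmap iota x (horner_alg 'X_i a) = peval iota (x i) a.
Proof.
apply: (@peval_lift _ _ _ _ (horner_alg ('X_i : {mpoly C[n]})) (mmap iota x)).
  by move=> c; rewrite /= horner_algC -mul_mpolyC mulr1 mmapC.
by rewrite /= horner_algX mmapX mmap1U.
Qed.

Definition plane_point (T : Type) (a b : T) (i : 'I_2) : T :=
  if i == ord0 then a else b.

Lemma plane_pointE T (v : 'I_2 -> T) i : plane_point (v ord0) (v ord_max) i = v i.
Proof.
rewrite /plane_point; case: eqP => [-> //|/eqP i0]; congr v; apply/val_inj.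
by case: i i0 => -[|[|]].
Qed.

Lemma closed_eq0 (C : closedFieldType) (p : {poly C}) : (forall a, p.[a] = 0) -> p = 0.
Proof.
move=> p0; apply/eqP; apply: contraT => /closed_nonrootP [a].
by rewrite rootE p0 eqxx.
Qed.

(** * Genus of graphs and of double covers, over an abstract fraction field F of C[u] *)

Section FractionField.
Variables (C : closedFieldType) (F : fieldType) (f : {rmorphism {poly C} -> F}).
Hypothesis f_inj : injective f.
Hypothesis quotientP :
  forall x, {ab : {poly C} * {poly C} | ab.2 != 0 & x = f ab.1 / f ab.2}.

Let D0 := frac_deriv quotientP (@deriv C).
Let D0D := frac_derivD f_inj quotientP (@derivD C) (@derivM C).
Let D0M := frac_derivM f_inj quotientP (@derivM C).
Let D0f := frac_deriv_embed f_inj quotientP (@derivM C).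

Lemma graph_has_genus_zero_fraction_field (X : ('I_2 -> C) -> Prop) (h : {poly C}) :
  (forall v, X v <-> v ord0 = h.[v ord_max]) -> has_genus X 0.
Proof.
move=> XE; pose iota : {rmorphism C -> F} := GRing.RMorphism.clone _ _ (f \o polyC) _.
pose x i := f (plane_point h 'X i).
have fE p : f p = peval iota (f 'X) p.
  by apply: (@peval_lift _ _ _ _ idfun f).
have u_inj : injective (peval iota (f 'X)) by move=> p r; rewrite -!fE => /f_inj.
have gen z : exists p r, r != 0 /\ z = peval iota (f 'X) p / peval iota (f 'X) r.
  by have [[p r] /= r0 ->] := quotientP z; exists p, r; rewrite -!fE.
have D_der : is_derivation iota D0.
  split; [move=> c|exact: D0D|exact: D0M].
  by rewrite -[iota c]/(f c%:P) [D0 _]D0f derivC rmorph0.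
have Du : D0 (f 'X) = 1 by rewrite [D0 _]D0f derivX rmorph1.
(* [m p] is the restriction of p to the graph, as a polynomial in the parameter u. *)
pose m := mmap polyC (plane_point h 'X).
have fm p : f (m p) = mmap iota x p by apply: (@rmorph_mmap _ _ _ _ f) => [c|i].
have mE p v : v ord0 = h.[v ord_max] -> (m p).[v ord_max] = p.@[v].
  move=> vE; apply: (@rmorph_mmap _ _ _ _ (horner_eval (v ord_max))).
    by move=> c; rewrite /= /horner_eval hornerC.
  move=> i; rewrite -[RHS]plane_pointE /= /horner_eval /plane_point.
  by case: ifP => _; rewrite ?hornerX ?vE.
exists F, iota, x, D0, (fun _ : 'I_0 => 0); split.
- split=> [p|z].
    split=> [p0 v /XE vE|p0].
      by rewrite -mE // (f_inj (_ : f (m p) = f 0)) ?horner0 // fm p0 rmorph0.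
    rewrite -fm (@closed_eq0 _ (m p)) ?rmorph0 // => a.
    have := @mE p (plane_point h.[a] a) (erefl _); rewrite /= => ->.
    by apply: p0; apply/XE.
  have [p [r [r0 ->]]] := gen z.
  exists (horner_alg 'X_ord_max p), (horner_alg 'X_ord_max r).
  by rewrite !mmap_horner_alg.
- exact: rational_derivation_basis u_inj gen D_der Du.
- split=> [[]//|g gr]; exists [ffun=> 0]; split.
    by rewrite big_ord0 (rational_regular_differential u_inj gen D_der Du gr).
  by move=> c _; apply/ffunP => -[].
Qed.

Section DoubleCover.
Hypothesis two_neq0 : 2%:R != 0 :> C.
Variable q : {poly C}.
Hypothesis q_size : (size q <= 5)%N.
Hypothesis q_nconst : size q != 1%N.
Hypothesis q_sep : forall x, root q x -> ~~ root q^`() x.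
Hypothesis q_sep_inf :
  forall x, root (reciprocal4 q) x -> ~~ root (reciprocal4 q)^`() x.

Lemma fraction_not_square (a : F) : a ^+ 2 != f q.
Proof.
have [[n d] /= d0 ->] := quotientP a; apply/eqP => e.
have D_neq0 : f d != 0 by rewrite -(rmorph0 f) (inj_eq f_inj).
case/eqP: d0; apply: (separable_not_square q_sep q_nconst (a := n)).
by apply: f_inj; rewrite !(rmorphXn, rmorphM) /= -e expr_div_n divfK ?expf_neq0.
Qed.

Let K : fieldType := quad_field fraction_not_square.
Let emb : {rmorphism F -> K} := quad_fieldC fraction_not_square.
Let iota : {rmorphism C -> K} := GRing.RMorphism.clone _ _ (emb \o f \o polyC) _.
Let u : K := emb (f 'X).
Let y : K := quad_root (f q).

Let embE p : peval iota u p = emb (f p).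
Proof. exact/esym/(@peval_lift _ _ _ _ f emb). Qed.

Let u_inj : injective (peval iota u).
Proof. by move=> p r; rewrite !embE => -[] /f_inj. Qed.

Let y2 : y ^+ 2 = peval iota u q.
Proof. by rewrite embE; apply: quad_root_sqr. Qed.

Let quad_coordE (z : K) : z = emb z.1 + emb z.2 * y.
Proof.
rewrite (quad_mulE (q := f q)) (quad_addE (q := f q)) /=.
by case: z => z1 z2; congr (_, _) => /=; ring.
Qed.

Let gen z : exists a b c d, [/\ b != 0, d != 0
  & z = peval iota u a / peval iota u b + peval iota u c / peval iota u d * y].
Proof.
have [[a b] /= b0 zE1] := quotientP z.1; have [[c d] /= d0 zE2] := quotientP z.2.
exists a, b, c, d; split=> //.
by rewrite !embE -!fmorph_div -zE1 -zE2 -quad_coordE.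
Qed.

(* y d/du *)
Let D (z : K) : K :=
  (D0 z.2 * f q + z.2 * f q^`() / 2%:R, D0 z.1).

Let D00 : D0 0 = 0. Proof. by rewrite -(rmorph0 f) [D0 _]D0f linear0. Qed.
Let D01 : D0 1 = 0. Proof. by rewrite -(rmorph1 f) [D0 _]D0f derivC rmorph0. Qed.
Let F2 : (2%:R : F) != 0.
Proof. by rewrite -(rmorph_nat (f \o polyC)) fmorph_eq0. Qed.

Let D_der : is_derivation iota D.
Proof.
split=> [c|a b|a b].
- congr (_, _) => /=; first by rewrite D00; ring.
  by rewrite [D0 _]D0f derivC rmorph0.
- by congr (_, _); rewrite /= /D0 !D0D -/D0; ring.
- have Dq : D0 (f q) = f q^`() by exact: D0f.
  rewrite !(quad_mulE (q := f q)) (quad_addE (q := f q)) /D /=.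
  by congr (_, _); rewrite /D0 !(D0D, D0M) -/D0 ?Dq; field.
Qed.

Let Du : D u = y.
Proof.
congr (_, _) => /=; first by rewrite D00; ring.
by rewrite [D0 _]D0f derivX rmorph1.
Qed.

Let Dy : D y *+ 2 = peval iota u q^`().
Proof.
rewrite embE mulr2n (quad_addE (q := f q)); congr (_, _) => /=.
  by rewrite D01; field.
by rewrite D00 addr0.
Qed.

Lemma double_cover_has_genus_one_fraction_field (X : ('I_2 -> C) -> Prop) :
  (forall v, X v <-> v ord0 ^+ 2 = q.[v ord_max]) -> has_genus X 1.
Proof.
move=> XE; pose x := plane_point y u.
(* [m p] is the class of p in the coordinate ring; [epsm] is its image in K and [phim] its value at
   a point. *)
pose m := mmap (fun c => quadC q c%:P) (plane_point (quad_root q) (quadC q 'X)).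
have epsm p : quad_lift y2 (m p) = mmap iota x p.
  apply: (@rmorph_mmap _ _ _ _ (quad_lift y2)) => [c|i].
    by rewrite /= quad_liftC /= pevalC.
  by rewrite /x /plane_point; case: ifP; rewrite /= (quad_lift_root, quad_liftC) /= ?pevalX.
have phim p v (vE : v ord0 ^+ 2 = horner_eval (v ord_max) q) :
    quad_lift vE (m p) = p.@[v].
  apply: (@rmorph_mmap _ _ _ _ (quad_lift vE)) => [c|i].
    by rewrite /= quad_liftC /= /horner_eval hornerC.
  rewrite -[RHS]plane_pointE /plane_point; case: ifP => _; rewrite /=.
    by rewrite quad_lift_root.
  by rewrite quad_liftC /= /horner_eval hornerX.
have eps_inj := quad_lift_inj u_inj q_sep q_nconst (y2 := y2).
exists K, iota, x, D, (fun _ => 1); split.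
- split=> [p|z].
    split=> [p0 v /XE vE|p0].
      rewrite -(phim p v vE) (_ : m p = 0) ?rmorph0 //.
      by apply: eps_inj; rewrite epsm p0 rmorph0.
    rewrite -epsm (_ : m p = 0) ?rmorph0 //.
    (* The norm of [m p] is a multiple of [m p], so it vanishes at every a: some point (a, b) lies
       on X, and p is zero there. *)
    apply: (quad_poly_norm_eq0 q_sep q_nconst); apply: closed_eq0 => a.
    have [b ab] : exists b, b ^+ 2 = q.[a].
      have /closed_rootP [b] : size ('X^2 - (q.[a])%:P) != 1%N by rewrite size_XnsubC.
      by rewrite rootE !hornerE subr_eq0 => /eqP; exists b.
    have vE : plane_point b a ord0 ^+ 2 = horner_eval (plane_point b a ord_max) q by [].
    have := quad_liftC vE (quad_norm (m p)); rewrite -quad_mul_conj rmorphM.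
    by rewrite /= phim p0 ?mul0r => [e|]; [exact: esym e | exact/XE].
  have [a [b [c [d [b0 d0 ->]]]]] := gen z.
  pose l := horner_alg ('X_ord_max : {mpoly C[2]}).
  exists (l a * l d + l b * l c * 'X_ord0), (l b * l d).
  rewrite rmorphD !rmorphM /= !mmap_horner_alg mmapX mmap1U.
  have B0 : peval iota u b != 0 by rewrite peval_eq0.
  have d0' : peval iota u d != 0 by rewrite peval_eq0.
  rewrite -[x ord_max]/u -[x ord0]/y; by field; rewrite B0 d0'.
- exact: (genus_one_derivation_basis two_neq0 u_inj q_nconst q_sep y2 gen D_der Du Dy).
- pose sigma : {rmorphism K -> K} := quad_field_conj (nsq := fraction_not_square).
  apply: (genus_one_differentials two_neq0 u_inj q_size q_nconst q_sep q_sep_inf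
    y2 gen D_der Du Dy (sigma := sigma)).
  + by move=> c; congr (_, _); rewrite /= oppr0.
  + by congr (_, _); rewrite /= oppr0.
  + by congr (_, _); rewrite /= oppr0.
Qed.

End DoubleCover.
End FractionField.

Lemma graph_has_genus_zero (C : closedFieldType) (X : ('I_2 -> C) -> Prop) h :
  (forall v, X v <-> v ord0 = h.[v ord_max]) -> has_genus X 0.
Proof.
have inj : injective (@FracField.tofrac {poly C}) by move=> a b /eqP; rewrite tofrac_eq => /eqP.
exact: (graph_has_genus_zero_fraction_field (f := @FracField.tofrac {poly C}) inj (@frac_quotient _)).
Qed.

Lemma double_cover_has_genus_one (C : closedFieldType) (q : {poly C})
    (X : ('I_2 -> C) -> Prop) :
  2%:R != 0 :> C -> (size q <= 5)%N -> size q != 1%N ->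
  (forall x, root q x -> ~~ root q^`() x) ->
  (forall x, root (reciprocal4 q) x -> ~~ root (reciprocal4 q)^`() x) ->
  (forall v, X v <-> v ord0 ^+ 2 = q.[v ord_max]) -> has_genus X 1.
Proof.
have inj : injective (@FracField.tofrac {poly C}) by move=> a b /eqP; rewrite tofrac_eq => /eqP.
move=> two_neq0 q_size q_nconst q_sep q_sep_inf XE.
exact: (double_cover_has_genus_one_fraction_field (f := @FracField.tofrac {poly C}) inj
  (@frac_quotient _) two_neq0 q_size q_nconst q_sep q_sep_inf XE).
Qed.

(** * Curves and the surface *)

Lemma mderiv_horner_alg (C : fieldType) n (u : {mpoly C[n]}) (p : {poly C}) i :
  (horner_alg u p)^`M(i) = horner_alg u p^`() * u^`M(i).
Proof.
elim/poly_ind: p => [|p c IH]; first by rewrite deriv0 !rmorph0 mderiv0 mul0r.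
rewrite derivD derivM derivX derivC addr0 mulr1 !(rmorphD, rmorphM) /=.
rewrite horner_algX horner_algC -mul_mpolyC mulr1 mderivD mderivM mderivC IH; ring.
Qed.

Lemma mderivXU (C : fieldType) n (i j : 'I_n) :
  ('X_j : {mpoly C[n]})^`M(i) = (i == j)%:R.
Proof.
rewrite mderivX mnm1E eq_sym; case: eqP => [->|_]; last by rewrite scale0r.
have -> : (U_(j) - U_(j) = 0 :> 'X_{1..n})%MM by apply/mnmP => l; rewrite !mnmE subnn.
by rewrite mpolyX0 scale1r.
Qed.

Section DoubleCoverPoints.
Variables (C : fieldType) (q : {poly C}).
Hypothesis two_neq0 : 2%:R != 0 :> C.

Lemma meval_double_cover v :
  (double_cover q).@[v] = v ord0 ^+ 2 - q.[v ord_max].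
Proof.
rewrite /double_cover mevalB rmorphXn /= meval_horner_alg !mevalXU.
by congr (v _ ^+ 2 - q.[v _]); apply/val_inj.
Qed.

Lemma mderiv_double_cover0 v :
  ((double_cover q)^`M(ord0)).@[v] = v ord0 *+ 2.
Proof.
rewrite /double_cover mderivB expr2 mderivM mderiv_horner_alg !mderivXU /=.
rewrite mulr0 subr0 mul1r mulr1 mevalD !mevalXU -mulr2n.
by congr (v _ *+ 2); apply/val_inj.
Qed.

Lemma mderiv_double_cover1 v :
  ((double_cover q)^`M(ord_max)).@[v] = - q^`().[v ord_max].
Proof.
rewrite /double_cover mderivB expr2 mderivM mderiv_horner_alg !mderivXU /=.
rewrite mul0r mulr0 addr0 sub0r mulr1 mevalN meval_horner_alg mevalXU.
by congr (- _.[v _]); apply/val_inj.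
Qed.

Lemma singular_point_double_cover v :
  singular_point (double_cover q) v <->
  [/\ v ord0 = 0, root q (v ord_max) & root q^`() (v ord_max)].
Proof.
rewrite /singular_point /zero_set meval_double_cover; split=> [[z d]|[v0 /eqP r0 /eqP r1]].
  have v0 : v ord0 = 0.
    have := d ord0; rewrite mderiv_double_cover0 -mulr_natr => /eqP.
    by rewrite mulf_eq0 (negPf two_neq0) orbF => /eqP.
  split=> //; apply/eqP; first by move/eqP: z; rewrite v0 expr0n sub0r oppr_eq0 => /eqP.
  by have /eqP := d ord_max; rewrite mderiv_double_cover1 oppr_eq0 => /eqP.
split=> [|i]; first by rewrite v0 r0 expr0n subrr.
case: (eqVneq i ord0) => [->|i0]; first by rewrite mderiv_double_cover0 v0 mul0rn.
have -> : i = ord_max by apply/val_inj; case: i i0 => -[|[|]].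
by rewrite mderiv_double_cover1 r1 oppr0.
Qed.

Lemma smooth_double_cover :
  (forall x, root q x -> ~~ root q^`() x) -> smooth (double_cover q).
Proof.
move=> q_sep v z; split=> //; have [v0|v0] := eqVneq (v ord0) 0.
  exists ord_max; rewrite mderiv_double_cover1 oppr_eq0; apply: q_sep.
  by move/eqP: z; rewrite meval_double_cover v0 expr0n sub0r oppr_eq0.
by exists ord0; rewrite mderiv_double_cover0 -mulr_natr mulf_neq0.
Qed.

End DoubleCoverPoints.

(** At 0 the reversal takes the value of the leading coefficient. Elsewhere it is x^4 q(1/x), whose
    derivative at a root is - x^2 q'(1/x). *)
Lemma reciprocal4_separable (C : fieldType) (q : {poly C}) : size q = 5%N ->
  (forall x, root q x -> ~~ root q^`() x) ->
  forall x, root (reciprocal4 q) x -> ~~ root (reciprocal4 q)^`() x.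
Proof.
move=> sq q_sep x; have lq : q`_4 != 0.
  by rewrite -[4%N]/(5.-1) -sq -lead_coefE lead_coef_eq0 -size_poly_eq0 sq.
have [->|x0] := eqVneq x 0.
  by rewrite rootE -[reciprocal4 q]/(polyrev 4 q) polyrev_at0 (negPf lq).
have rE : (reciprocal4 q).[x] = x ^+ 4 * q.[x^-1].
  rewrite (@horner_coef_wide _ 5) ?size_poly // (@horner_coef_wide _ 5 q) ?sq //.
  by rewrite !big_ord_recl !big_ord0 /= !coef_poly /=; field.
have r'E : (reciprocal4 q)^`().[x] = x ^+ 3 * q.[x^-1] *+ 4 - x ^+ 2 * q^`().[x^-1].
  have sd (p : {poly C}) : (size p <= 5 -> size p^`() <= 4)%N.
    by move=> sp; apply: leq_trans (size_poly _ _) _; case: (size p) sp.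
  rewrite (@horner_coef_wide _ 4 (_^`())); last by rewrite sd ?size_poly.
  rewrite (@horner_coef_wide _ 4 (q^`())); last by rewrite sd ?sq.
  rewrite (@horner_coef_wide _ 5 q) ?sq //.
  by rewrite !big_ord_recl !big_ord0 /= !coef_deriv !coef_poly /= /bump /=; field.
rewrite !rootE rE r'E mulf_eq0 expf_eq0 (negPf x0) /= => q0.
rewrite (eqP q0) mulr0 mul0rn sub0r oppr_eq0 mulf_neq0 ?expf_neq0 //.
exact: q_sep.
Qed.

Lemma big_ord3_uniq (T : Type) (idx : T) (op : Monoid.com_law idx) (F : 'I_3 -> T)
    (i j k : 'I_3) : uniq [:: i; j; k] ->
  \big[op/idx]_(l < 3) F l = op (F i) (op (F j) (F k)).
Proof.
move=> ijk; rewrite (eq_bigl (mem 'I_3)) // -big_enum.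
have h : enum 'I_3 =i [:: i; j; k].
  have s3 : (size (enum 'I_3) <= size [:: i; j; k])%N by rewrite size_enum_ord.
  have [|_ h x] := uniq_min_size ijk _ s3; first by move=> x _; rewrite mem_enum.
  by rewrite h.
rewrite (perm_big [:: i; j; k]); last by apply: uniq_perm => //; exact: enum_uniq.
by rewrite !big_cons big_nil Monoid.mulm1.
Qed.

(** * Singularities and components of the fibers, smoothness of the surface *)

Section Fibration.
Variables (C : numClosedFieldType) (e : 'I_3 -> C).
Hypotheses (e_inj : injective e) (e_sum : \sum_(i < 3) e i = 0).

Let two_neq0 : 2%:R != 0 :> C. Proof. by rewrite pnatr_eq0. Qed.
Let four_neq0 : 4%:R != 0 :> C. Proof. by rewrite pnatr_eq0. Qed.

Section Indices.
Variables i j k : 'I_3.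
Hypothesis ijk : uniq [:: i; j; k].

Lemma e_last : e k = - (e i + e j).
Proof.
have := e_sum; rewrite (big_ord3_uniq _ _ ijk) /= addrA => /eqP.
by rewrite addrC addr_eq0 => /eqP.
Qed.

Lemma cubic_factor : cubic e = ('X - (e i)%:P) * (('X - (e j)%:P) * ('X - (e k)%:P)).
Proof. exact: (big_ord3_uniq _ _ ijk). Qed.

(** Coefficients of f with e k = - (e i + e j) eliminated, so that [ring] needs no relation between
    the roots. *)
Definition cubic1 : C := - (e i ^+ 2 + e i * e j + e j ^+ 2).
Definition cubic0 : C := e i * e j * (e i + e j).

Lemma cubicE : cubic e = 'X^3 + cubic1%:P * 'X + cubic0%:P.
Proof.
rewrite cubic_factor e_last /cubic1 /cubic0.
by rewrite !(rmorphN, rmorphD, rmorphM, rmorphXn) /=; ring.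
Qed.

Lemma cubic_horner x : (cubic e).[x] = x ^+ 3 + cubic1 * x + cubic0.
Proof. by rewrite cubicE !hornerE. Qed.

Lemma cubic_deriv_horner x : (cubic e)^`().[x] = x ^+ 2 *+ 3 + cubic1.
Proof. by rewrite cubicE !derivE !hornerE /=; ring. Qed.

Lemma cubic_deriv2_horner x : (cubic e)^`()^`().[x] = x *+ 6.
Proof. by rewrite cubicE !derivE !hornerE /=; ring. Qed.

Lemma quartic_horner w x : (fiber_quartic e w).[x] =
  - (x *+ 2 + w) * (x ^+ 3 + cubic1 * x + cubic0)
  + 4%:R^-1 * (x ^+ 2 *+ 3 + cubic1) ^+ 2.
Proof.
rewrite /fiber_quartic /rhs !horner_alg_polyX !hornerE.
by rewrite cubic_horner cubic_deriv_horner; ring.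
Qed.

(** As f'' = 6x, the terms f' f'' / 2 and - (2x + w) f' add up to (x - w) f'. *)
Lemma quartic_deriv_horner w x : (fiber_quartic e w)^`().[x] =
  - (x ^+ 3 + cubic1 * x + cubic0) *+ 2 + (x - w) * (x ^+ 2 *+ 3 + cubic1).
Proof.
rewrite /fiber_quartic /rhs !horner_alg_polyX !derivE !hornerE.
rewrite cubic_horner cubic_deriv_horner cubic_deriv2_horner.
by field.
Qed.

End Indices.

Lemma e_neq i j : i != j -> e i - e j != 0.
Proof. by apply: contraNneq => /eqP; rewrite subr_eq0 => /eqP /e_inj ->. Qed.

Let i0 : 'I_3 := inord 0.
Let i1 : 'I_3 := inord 1.
Let i2 : 'I_3 := inord 2.

Let i012 : uniq [:: i0; i1; i2].
Proof. by rewrite /= !inE -!val_eqE /= !inordK. Qed.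

Lemma ord3_uniq (i : 'I_3) : exists j k, uniq [:: i; j; k].
Proof.
have : i \in [:: i0; i1; i2].
  by case: i => -[|[|[|//]]] h; rewrite !inE -!val_eqE /= !inordK.
by rewrite !inE => /or3P [] /eqP ->; [exists i1, i2|exists i0, i2|exists i0, i1];
  rewrite /= !inE -!val_eqE /= !inordK.
Qed.

Lemma cubic_root x : root (cubic e) x -> exists i, x = e i.
Proof.
rewrite /cubic rootE horner_prod prodf_seq_eq0 => /hasP [i _].
by rewrite hornerXsubC subr_eq0 => /eqP ->; exists i.
Qed.

Lemma cubic_separable x : root (cubic e) x -> ~~ root (cubic e)^`() x.
Proof.
move=> /cubic_root [i ->]; have [j [k ijk]] := ord3_uniq i.
rewrite rootE (cubic_deriv_horner ijk) (_ : _ + _ = (e i - e j) * (e i - e k)).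
  move: ijk; rewrite /= !inE negb_or => /andP [/andP [ij ik] _].
  by rewrite mulf_neq0 // e_neq.
by rewrite (e_last ijk) /cubic1; ring.
Qed.

Lemma quartic_double_root w x : root (fiber_quartic e w) x ->
  root (fiber_quartic e w)^`() x -> exists i, w = e i.
Proof.
rewrite !rootE (quartic_horner i012) (quartic_deriv_horner i012).
set A := cubic1 _ _; set B := cubic0 _ _ => /eqP q0 /eqP q1.
apply: cubic_root; rewrite rootE (cubic_horner i012) -/A -/B.
set S := - _ *+ 2 + _ in q1.
set Q := _ + _ in q0.
pose F' := x ^+ 2 *+ 3 + A; pose G := F' - (x *+ 2 + w) * (x - w) *+ 2.
(* Eliminating f(x) between the quartic and its derivative leaves a multiple of f'(x). *)
have e1 : F' * G = 0.
  transitivity (4%:R * Q - (x *+ 2 + w) * S *+ 2); first by rewrite /Q /S /G /F'; field.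
  by rewrite q0 q1; ring.
(* If f'(x) = 0, the vanishing derivative of the quartic reduces to - 2 f(x), and f would have a
   double root. *)
have F'0 : F' != 0.
  apply/negP => /eqP F'0; have F0 : x ^+ 3 + A * x + B = 0.
    apply: (mulfI two_neq0); rewrite mulr0; move: q1; rewrite /S -/F' F'0.
    by rewrite mulr0 addr0 mulNrn => /eqP; rewrite oppr_eq0 mulr_natl => /eqP.
  have := @cubic_separable x; rewrite !rootE (cubic_horner i012).
  by rewrite (cubic_deriv_horner i012) -/A -/B -/F' F'0 F0 eqxx => /(_ isT).
have G0 : G = 0 by apply: (mulfI F'0); rewrite e1 mulr0.
rewrite -(mulrI_eq0 _ (mulfI two_neq0)).
(* This is the Taylor expansion f(w) = f(x) + (w - x) f'(x) + (w - x)^2 (2x + w), doubled. *)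
suff -> : 2%:R * (w ^+ 3 + A * w + B) = - (x - w) * G - S by rewrite G0 q1 mulr0 subr0.
by rewrite /G /S /F'; ring.
Qed.

Section Component.
Variables i j k : 'I_3.
Hypothesis ijk : uniq [:: i; j; k].
Let c := (e i - e j) * (e i - e k).

(** With t = x - e_i one has f = t (t^2 + 3 e_i t + c) and 2x + e_i = 2t + 3 e_i; the terms in t^3
    and t cancel and (t^2 - c)^2 / 4 remains. *)
Lemma singular_quartic_horner x :
  (fiber_quartic e (e i)).[x] = (((x - e i) ^+ 2 - c) / 2%:R) ^+ 2.
Proof.
by rewrite (quartic_horner ijk) /c (e_last ijk) /cubic1 /cubic0; field.
Qed.

Lemma singular_quartic_deriv_horner x :
  (fiber_quartic e (e i))^`().[x] = ((x - e i) ^+ 2 - c) * (x - e i).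
Proof.
by rewrite (quartic_deriv_horner ijk) /c (e_last ijk) /cubic1 /cubic0; ring.
Qed.

Lemma component_zero s v : zero_set (fiber_component e s i j k) v <->
  v ord0 = s / 2%:R * ((v ord_max - e i) ^+ 2 - c).
Proof.
rewrite /zero_set /fiber_component mevalB mevalZ mevalB rmorphXn /= mevalB !mevalC !mevalXU.
have -> : (0 : 'I_2) = ord0 by exact/val_inj.
have -> : (1 : 'I_2) = ord_max by exact/val_inj.
by split=> [/eqP|->]; rewrite ?subrr // subr_eq0 => /eqP.
Qed.

Lemma component_has_genus_zero s : has_genus (zero_set (fiber_component e s i j k)) 0.
Proof.
apply: (@graph_has_genus_zero _ _ ((s / 2%:R) *: (('X - (e i)%:P) ^+ 2 - c%:P))) => v.
by rewrite component_zero !hornerE.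
Qed.

Lemma double_root_neq0 : sqrtC c != 0.
Proof.
move: ijk; rewrite sqrtC_eq0 /= !inE negb_or => /andP [/andP [ij ik] _].
by rewrite mulf_neq0 // e_neq.
Qed.

Lemma component_intersection x : (x - e i) ^+ 2 - c = 0 <->
  x = e i + sqrtC c \/ x = e i - sqrtC c.
Proof.
have -> : (x - e i) ^+ 2 - c = (x - (e i + sqrtC c)) * (x - (e i - sqrtC c)).
  by rewrite -[in LHS](sqrtCK c); ring.
split=> [/eqP|[|] ->]; last 2 first.
- by rewrite subrr mul0r.
- by rewrite subrr mulr0.
by rewrite mulf_eq0 !subr_eq0 => /orP [] /eqP; [left|right].
Qed.

End Component.

Lemma zero_fiber w v :
  zero_set (fiber e w) v <-> v ord0 ^+ 2 = (fiber_quartic e w).[v ord_max].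
Proof.
rewrite /zero_set /fiber meval_double_cover.
by split=> [/eqP|->]; rewrite ?subrr // subr_eq0 => /eqP.
Qed.

Lemma singular_fiber w : singular (fiber e w) <-> exists i, w = e i.
Proof.
split=> [[v /(singular_point_double_cover _ two_neq0) [_]]|[i ->]].
  exact: quartic_double_root.
have [j [k ijk]] := ord3_uniq i.
(* A common point of the two components: the quartic and its derivative are both divisible by (x -
   e_i)^2 - c. *)
pose x := e i + sqrtC ((e i - e j) * (e i - e k)).
have x0 : (x - e i) ^+ 2 - (e i - e j) * (e i - e k) = 0.
  by apply/component_intersection; left.
exists (plane_point 0 x); apply/(singular_point_double_cover _ two_neq0).
rewrite !rootE (singular_quartic_horner ijk) (singular_quartic_deriv_horner ijk).
by rewrite /= x0 !mul0r expr0n eqxx.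
Qed.

Lemma size_fiber_quartic w : size (fiber_quartic e w) = 5%N.
Proof.
have := cubicE i012; move: (cubic1 _ _) (cubic0 _ _) => A B cE.
(* The leading coefficient is 9/4 - 2 = 1/4. With h as a variable, 8 h = 2 is all that the
   polynomial identity requires. *)
pose h := (4%:R^-1 : C)%:P.
have h8 : h *+ 8 - 2%:R = 0.
  by rewrite /h -(rmorph_nat polyC) -rmorphMn -rmorphB -polyC0; congr polyC; field.
have -> : fiber_quartic e w = (((h * 'X + (- w)%:P) * 'X + (- (4%:R^-1 * A *+ 2))%:P) * 'X
    + (- (B *+ 2 + A * w))%:P) * 'X + (4%:R^-1 * A ^+ 2 - w * B)%:P.
  rewrite /fiber_quartic /rhs !horner_alg_polyX cE !derivE.
  rewrite -mul_polyC -/h.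
  rewrite !(rmorphN, rmorphB, rmorphD, rmorphMn, rmorphXn, rmorphM) /= -/h.
  apply/eqP; rewrite -subr_eq0; apply/eqP.
  transitivity ((h *+ 8 - 2%:R) * ('X^4 + A%:P * 'X^2)); last by rewrite h8 mul0r.
  ring.
have sizeMXaddC (p : {poly C}) c n : size p = n.+1 -> size (p * 'X + c%:P) = n.+2.
  by move=> sp; rewrite size_MXaddC -size_poly_eq0 sp.
by do 4!apply: (sizeMXaddC); rewrite size_polyC invr_eq0 four_neq0.
Qed.

Lemma smooth_fiber w : (forall i, w <> e i) ->
  smooth_completed_double_cover (fiber_quartic e w)
  /\ has_genus (zero_set (fiber e w)) 1.
Proof.
move=> we; have sq := size_fiber_quartic w.
have q_sep x : root (fiber_quartic e w) x -> ~~ root (fiber_quartic e w)^`() x.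
  by move=> r0; apply/negP => r1; have [i /we] := quartic_double_root r0 r1.
have q_sep_inf := reciprocal4_separable sq q_sep.
split; first by split=> //; apply: smooth_double_cover.
by apply: (double_cover_has_genus_one two_neq0 _ _ q_sep q_sep_inf (zero_fiber w)); rewrite sq.
Qed.

(** The derivatives in rho and w are 2 rho and f(u). If both vanish, the equation leaves f'(u)^2 =
    0, against the separability of f. *)
Lemma smooth_surface : smooth (surface e).
Proof.
move=> v z; split=> //.
have E0 : ((surface e)^`M(0)).@[v] = v 0 *+ 2.
  rewrite /surface /rhs mderivB expr2 mderivM mderivD mderivM mderivN mderivD mderivMn.
  rewrite mderivZ expr2 mderivM !mderiv_horner_alg !mderivXU /=.
  by rewrite !(mulr0, mul0r, mul0rn, addr0, oppr0, scaler0, mulr1, mul1r, subr0) mevalD mevalXU mulr2n.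
have E2 : ((surface e)^`M(2)).@[v] = (cubic e).[v 1].
  rewrite /surface /rhs mderivB expr2 mderivM mderivD mderivM mderivN mderivD mderivMn.
  rewrite mderivZ expr2 mderivM !mderiv_horner_alg !mderivXU /=.
  rewrite !(mulr0, mul0r, mul0rn, addr0, add0r, oppr0, scaler0).
  by rewrite mulN1r opprK meval_horner_alg mevalXU.
have [v0|v0] := eqVneq (v 0) 0; last by exists 0; rewrite E0 -mulr_natr mulf_neq0.
have [f0|f0] := eqVneq ((cubic e).[v 1]) 0; last by exists 2; rewrite E2.
have := cubic_separable (introT eqP f0); rewrite rootE => /negP; case.
move: z; rewrite /zero_set /surface /rhs mevalB rmorphXn mevalD mevalM mevalZ rmorphXn /=.
rewrite !meval_horner_alg !mevalXU v0 f0 mulr0 add0r expr0n sub0r => /eqP.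
by rewrite oppr_eq0 mulf_eq0 invr_eq0 (negPf four_neq0) sqrf_eq0.
Qed.

End Fibration.

Theorem mainTheorem2 (R : realType) (e : 'I_3 -> R[i])
    (e_inj : injective e) (e_sum : \sum_(i < 3) e i = 0) :
  (* (i) *)
  [/\ (forall w : R[i], singular (fiber e w) <-> exists i : 'I_3, w = e i)
      /\ (forall w : R[i], (forall i : 'I_3, w <> e i) ->
            smooth_completed_double_cover (fiber_quartic e w)
            /\ has_genus (zero_set (fiber e w)) 1),
  (* (ii) *)
      forall i j k : 'I_3, uniq [:: i; j; k] ->
        let Fp := zero_set (fiber_component e 1 i j k) in
        let Fm := zero_set (fiber_component e (-1) i j k) in
        let r := sqrtC ((e i - e j) * (e i - e k)) in
        [/\ forall v, zero_set (fiber e (e i)) v <-> Fp v \/ Fm v,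
            has_genus Fp 0,
            has_genus Fm 0,
            forall v, Fp v /\ Fm v <->
              v ord0 = 0 /\ (v ord_max = e i + r \/ v ord_max = e i - r)
          & e i + r <> e i - r]
  (* (iii) *)
    & smooth (surface e)
      /\ (forall (i : 'I_3) (v : 'I_2 -> R[i]),
            singular_point (fiber e (e i)) v ->
            smooth_point (surface e) (point3 v (e i)))].
Proof.
split.
- split; first exact: singular_fiber e_inj e_sum.
  exact: smooth_fiber e_inj e_sum.
- move=> i j k ijk Fp Fm r.
  split; [| exact: component_has_genus_zero | exact: component_has_genus_zero | |].
  + move=> v; rewrite zero_fiber (singular_quartic_horner e_sum ijk).
    rewrite [Fp v]component_zero [Fm v]component_zero mul1r mulN1r mulNr [_^-1 * _]mulrC.
    split=> [/eqP|[] ->]; last 2 first.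
    * by [].
    * by rewrite sqrrN.
    by rewrite eqf_sqr => /orP [] /eqP; [left|right].
  + move=> v; rewrite [Fp v]component_zero [Fm v]component_zero -component_intersection.
    set T := _ - _; split=> [[h1 h2]|[-> ->]]; last by rewrite !mulr0.
    have v0 : v ord0 = 0.
      have : v ord0 *+ 2 = 0 by rewrite mulr2n {1}h1 h2; ring.
      by move/eqP; rewrite mulrn_eq0 => /eqP.
    split=> //; move: h1; rewrite v0 mul1r => /esym/eqP.
    by rewrite mulf_eq0 invr_eq0 pnatr_eq0 => /eqP.
  + move=> /addrI /eqP; rewrite eq_sym -subr_eq0 -opprD -mulr2n oppr_eq0 mulrn_eq0 /=.
    by apply/negP/(double_root_neq0 e_inj ijk).
- split; first exact: smooth_surface e_inj e_sum.
  move=> i v [z _]; apply: (smooth_surface e_inj e_sum).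
  by rewrite /zero_set -meval_fiber.
Qed.
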